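(* Let $k\ge1$, let $\alpha_1,\beta_1,\beta_2\in\mathbb{R}$ (possibly depending on $h$) with $\alpha_1^2+\beta_1\beta_2\ne\frac14$, assume a uniform mesh of size $h$, and suppose $|\Gamma|<|\Lambda|$ (Case 3) and that $P_h^\star$ is well defined, i.e. $\lambda_1^N\ne1$. Assume $|1-\lambda_1^N|=O(h^{\delta'})$ and $|\lambda_1-1|=O(h^{\delta/2})$ with $0\le\delta/2\le1$. Then for $p=2,\infty$ and periodic $u\in W^{k+3,\infty}(I)$, $$\|P_h^\star u-u\|_{L^p(I)}\le Ch^{k+1}\|u\|_{W^{k+3,\infty}(I)}\Big(1+h^{-(\delta'+\delta/2)}\|Q_1\|_\infty\big(\|V_1\|_\infty+h^{-1}\|V_2\|_\infty\big)\Big).$$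
   Context: Mesh: $I=[a,b]$, $a=x_{1/2}<\dots<x_{N+1/2}=b$, $I_j=(x_{j-1/2},x_{j+1/2})$, uniform with $h=(b-a)/N$. $V_h^k$ is the space of functions on $I$ whose restriction to each $I_j$ is a polynomial of degree at most $k$. At an interface, $v^\pm$ denote the limits from the right ($+$) and left ($-$) cells, with periodic identification of $x_{1/2}$ and $x_{N+1/2}$; $[v]=v^+-v^-$, $\{v\}=\frac12(v^++v^-)$; the same notation is used for the piecewise derivative $v_x$. Projection $P_h^\star$ (depending on $\alpha_1,\beta_1,\beta_2$): for a periodic function $u$, $P_h^\star u$ is the unique $w\in V_h^k$ satisfying, for all $j=1,\dots,N$, (i) $\int_{I_j}w\,v_h\,dx=\int_{I_j}u\,v_h\,dx$ for all $v_h\in P^{k-2}(I_j)$ (void if $k=1$); (ii) $\{w\}-\alpha_1[w]+\beta_2[w_x]=u$ at $x_{j+1/2}$; (iii) $\{w_x\}+\alpha_1[w_x]+\beta_1[w]=u_x$ at $x_{j+1/2}$. Quantities: $\Gamma=\beta_1+\frac{k^2(k^2-1)}{h^2}\beta_2-\frac{2k^2}{h}(\alpha_1^2+\beta_1\beta_2+\frac14)$, $\Lambda=-\frac{2k}{h}(\alpha_1^2+\beta_1\beta_2-\frac14)$, $c_2=\frac{2k\alpha_1}{h}$, $b_1=-\beta_1-\frac{k^2(k^2+1)}{h^2}\beta_2+\frac{2k^2}{h}(\alpha_1^2+\beta_1\beta_2+\frac14)$, $b_2=-\frac{2k^3}{h^2}\beta_2+\frac{2k}{h}(\alpha_1^2+\beta_1\beta_2+\frac14)$,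 $\lambda_1=\frac{(-1)^{k+1}}{\Lambda}(\Gamma+\sqrt{\Gamma^2-\Lambda^2})$, where $\sqrt{\Gamma^2-\Lambda^2}=i\sqrt{\Lambda^2-\Gamma^2}$ (so $|\lambda_1|=1$), $$Q_1=\frac{1}{2\sqrt{\Gamma^2-\Lambda^2}}\begin{bmatrix}c_2+\sqrt{\Gamma^2-\Lambda^2}&b_1+b_2\\ b_1-b_2&-c_2+\sqrt{\Gamma^2-\Lambda^2}\end{bmatrix},$$ $$V_1=\frac1\Lambda\begin{bmatrix}-\beta_1+\frac{k(k+1)}{h}\big((\frac12-\alpha_1)^2+\beta_1\beta_2\big)\\ \beta_1-\frac{k(k-1)}{h}\big((\frac12-\alpha_1)^2+\beta_1\beta_2\big)\end{bmatrix},\quad V_2=\begin{bmatrix}-\frac{h}{2k}\\ \frac{h}{2k}\end{bmatrix}.$$ $\|\cdot\|_\infty$ is the max norm of vectors and the induced matrix norm. In the two assumptions, $X=O(h^{s})$ means that $X$ is of exact order $h^s$ during mesh refinement, i.e. bounded above and below by positive constants (independent of $h$) times $h^s$; the constant $C$ may depend on these constants. ''Periodic $u\in W^{m,\infty}(I)$'' means that the $(b-a)$-periodic extension of $u$ has this regularity; $\|u\|_{W^{m,\infty}(I)}$ is the full Sobolev norm. Apart from the dependence just mentioned, $C$ is a generic constant independent of $h$, of $\alpha_1,\beta_1,\beta_2$, and of $u$. *)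

(* Defs.v *)
From mathcomp Require Export all_boot all_order all_algebra.
From mathcomp Require Export all_classical all_reals all_analysis.
From mathcomp Require Export complex.
Export Order.TTheory GRing.Theory Num.Theory.
Export numFieldNormedType.Exports.

Set Implicit Arguments.
Unset Strict Implicit.
Unset Printing Implicit Defensive.

Local Open Scope classical_set_scope.
Local Open Scope ring_scope.

(* The L^p norm, p in [1, +oo], of f restricted to the set D. *)
Definition Lp_norm (R : realType) (D : set R) (p : \bar R) (f : R -> R) : \bar R :=
  ('N[@lebesgue_measure R]_p[EFin \o (f \_ D)])%E.

(** Sobolev spaces W^{m,oo} on the line *)

(* In dimension one it is enough to test against C^1 functions with compact
   support (Brezis, Functional Analysis, Sobolev Spaces and PDE, Section 8.2). *)
Definition test_function (R : realType) (phi : R -> R) : Prop :=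
  [/\ forall x, derivable phi x 1,
      continuous (derive1 phi) &
      exists M : R, forall x, M < `|x| -> phi x = 0].

Definition is_weak_derivative (R : realType) (f g : R -> R) : Prop :=
  [/\ locally_integrable setT f,
      locally_integrable setT g &
      forall phi : R -> R, test_function phi ->
        (\int[@lebesgue_measure R]_x (f x * derive1 phi x))%R =
        - (\int[@lebesgue_measure R]_x (g x * phi x))%R].

Definition in_Linfty (R : realType) (f : R -> R) : Prop :=
  measurable_fun setT f /\ (Lp_norm setT +oo%E f < +oo)%E.

Fixpoint in_Winfty (R : realType) (m : nat) (f : R -> R) : Prop :=
  match m with
  | 0%N => in_Linfty f
  | m'.+1 => in_Linfty f /\
             exists g : R -> R, is_weak_derivative f g /\ in_Winfty m' g
  end.

(* Weak derivatives are unique only almost everywhere; the representative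
   chosen here has no influence on the norm below. *)
Definition weak_derivative (R : realType) (f : R -> R) : R -> R :=
  xget (cst 0) [set g | is_weak_derivative f g].

Definition Winfty_norm (R : realType) (D : set R) (m : nat) (f : R -> R) : \bar R :=
  (\big[maxe/0]_(i < m.+1) Lp_norm D +oo (iter i (@weak_derivative R) f))%E.

Definition periodic (R : realType) (L : R) (f : R -> R) : Prop :=
  forall x, f (x + L) = f x.

(** Uniform mesh.  Cells are numbered from 0: cell j is ]node j, node j.+1[,
    so node i stands for x_{i+1/2} and the interfaces x_{j+1/2}, 1 <= j <= N,
    are the points node j.+1 with j : 'I_N. *)

Definition meshsize (R : realType) (a b : R) (N : nat) : R := (b - a) / N%:R.

Definition node (R : realType) (a b : R) (N i : nat) : R :=
  a + i%:R * meshsize a b N.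

Definition cell (R : realType) (a b : R) (N j : nat) : set R :=
  `]node a b N j, node a b N j.+1[.

(* Values outside the open cells are irrelevant: v is only used through its
   one-sided limits at the nodes and through integrals. *)
Definition in_Vh (R : realType) (a b : R) (N k : nat) (v : R -> R) : Prop :=
  forall j : 'I_N, exists q : {poly R},
    (size q <= k.+1)%N /\ forall x, cell a b N j x -> v x = q.[x].

(* Traces at node j.+1.  The right trace is taken from cell (j + 1) mod N,
   which identifies node N with node 0. *)
Definition trace_left (R : realType) (a b : R) (N j : nat) (v : R -> R) : R :=
  lim (v x @[x --> (node a b N j.+1)^'-]).

Definition trace_right (R : realType) (a b : R) (N j : nat) (v : R -> R) : R :=
  lim (v x @[x --> (node a b N (j.+1 %% N))^'+]).

Definition jump (R : realType) (a b : R) (N j : nat) (v : R -> R) : R :=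
  trace_right a b N j v - trace_left a b N j v.

Definition average (R : realType) (a b : R) (N j : nat) (v : R -> R) : R :=
  (trace_right a b N j v + trace_left a b N j v) / 2.

(* w = P_h^* u.  A polynomial of degree at most k - 2 has size at most k - 1,
   so for k = 1 only the zero polynomial is tested in the first condition. *)
Definition is_Pstar (R : realType) (a b : R) (N k : nat)
    (alpha1 beta1 beta2 : R) (u w : R -> R) : Prop :=
  in_Vh a b N k w /\
  forall j : 'I_N,
  [/\ forall q : {poly R}, (size q <= k.-1)%N ->
        (\int[@lebesgue_measure R]_(x in cell a b N j) (w x * q.[x]))%R =
        (\int[@lebesgue_measure R]_(x in cell a b N j) (u x * q.[x]))%R,
      average a b N j w - alpha1 * jump a b N j w
        + beta2 * jump a b N j (derive1 w) = u (node a b N j.+1) &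
      average a b N j (derive1 w) + alpha1 * jump a b N j (derive1 w)
        + beta1 * jump a b N j w = derive1 u (node a b N j.+1)].

(** Parameters of the block-circulant system *)

Definition Gamma_ (R : realType) (k : nat) (h alpha1 beta1 beta2 : R) : R :=
  beta1 + k%:R ^+ 2 * (k%:R ^+ 2 - 1) / h ^+ 2 * beta2
  - 2 * k%:R ^+ 2 / h * (alpha1 ^+ 2 + beta1 * beta2 + 1 / 4).

Definition Lambda_ (R : realType) (k : nat) (h alpha1 beta1 beta2 : R) : R :=
  - (2 * k%:R / h) * (alpha1 ^+ 2 + beta1 * beta2 - 1 / 4).

Definition c2_ (R : realType) (k : nat) (h alpha1 : R) : R :=
  2 * k%:R * alpha1 / h.

Definition b1_ (R : realType) (k : nat) (h alpha1 beta1 beta2 : R) : R :=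
  - beta1 - k%:R ^+ 2 * (k%:R ^+ 2 + 1) / h ^+ 2 * beta2
  + 2 * k%:R ^+ 2 / h * (alpha1 ^+ 2 + beta1 * beta2 + 1 / 4).

Definition b2_ (R : realType) (k : nat) (h alpha1 beta1 beta2 : R) : R :=
  - (2 * k%:R ^+ 3 / h ^+ 2) * beta2
  + 2 * k%:R / h * (alpha1 ^+ 2 + beta1 * beta2 + 1 / 4).

(* sqrt(Gamma^2 - Lambda^2) = i sqrt(Lambda^2 - Gamma^2), for |Gamma| < |Lambda|. *)
Definition sqrt_disc (R : realType) (k : nat) (h alpha1 beta1 beta2 : R) : R[i] :=
  Complex 0 (Num.sqrt (Lambda_ k h alpha1 beta1 beta2 ^+ 2
                       - Gamma_ k h alpha1 beta1 beta2 ^+ 2)).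

Definition lambda1 (R : realType) (k : nat) (h alpha1 beta1 beta2 : R) : R[i] :=
  (-1) ^+ k.+1 / (Lambda_ k h alpha1 beta1 beta2)%:C%C
  * ((Gamma_ k h alpha1 beta1 beta2)%:C%C + sqrt_disc k h alpha1 beta1 beta2).

Definition mx22 (T : nzRingType) (x y z t : T) : 'M[T]_2 :=
  \matrix_(i, j) nth 0 (nth [::] [:: [:: x; y]; [:: z; t]] i) j.

Definition col2 (T : nzRingType) (x y : T) : 'cV[T]_2 :=
  \col_i nth 0 [:: x; y] i.

Definition Q1_ (R : realType) (k : nat) (h alpha1 beta1 beta2 : R) : 'M[R[i]]_2 :=
  let s := sqrt_disc k h alpha1 beta1 beta2 in
  let c2 := (c2_ k h alpha1)%:C%C in
  let b1 := (b1_ k h alpha1 beta1 beta2)%:C%C in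
  let b2 := (b2_ k h alpha1 beta1 beta2)%:C%C in
  (2 * s)^-1 *: mx22 (c2 + s) (b1 + b2) (b1 - b2) (- c2 + s).

Definition V1_ (R : realType) (k : nat) (h alpha1 beta1 beta2 : R) : 'cV[R]_2 :=
  let t := (1 / 2 - alpha1) ^+ 2 + beta1 * beta2 in
  (Lambda_ k h alpha1 beta1 beta2)^-1 *:
    col2 (- beta1 + k%:R * (k%:R + 1) / h * t)
         (beta1 - k%:R * (k%:R - 1) / h * t).

Definition V2_ (R : realType) (k : nat) (h : R) : 'cV[R]_2 :=
  col2 (- (h / (2 * k%:R))) (h / (2 * k%:R)).

Definition cmod (R : realType) (z : R[i]) : R := ComplexField.Normc.normc z.

Definition vnorm_oo (R : realType) (n : nat) (v : 'cV[R[i]]_n) : R :=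
  \big[Num.max/0]_(i < n) cmod (v i ord0).

Definition mnorm_oo (R : realType) (n : nat) (A : 'M[R[i]]_n) : R :=
  sup [set vnorm_oo (A *m v) | v in [set v : 'cV[R[i]]_n | vnorm_oo v <= 1]].

Definition complexify (R : realType) (n : nat) (v : 'cV[R]_n) : 'cV[R[i]]_n :=
  map_mx (fun x : R => x%:C%C) v.

(* X is of exact order h^s, with explicit constants. *)
Definition exact_order (R : realType) (cl cu X h s : R) : Prop :=
  cl * h `^ s <= X /\ X <= cu * h `^ s.

(* Main.v *)
(* Write e = P_h^* u - u and k = m.+1.  Since u is W^{k+3,oo}, it is classically
   smooth up to order k+2, with derivatives bounded by the Sobolev norm.
   Integrating e^(k+1) by parts against t^(k-1) (t-1)^k and t^k (t-1)^(k-1) on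
   the reference cell, the moment conditions remove the volume terms and leave
   two linear relations between the end data (e, e_x) of one cell, with defect
   O(h^(k+1)).  The interface conditions are homogeneous in e; eliminating
   gives a 2x2 recursion from one cell to the next whose matrix has eigenvalues
   lambda1 and its conjugate, Q1 being the spectral projector for lambda1.
   Hence z_j = Q1 c_j obeys the scalar recursion z_j = lambda1 (z_(j+1) - g_(j+1));
   periodicity gives a factor 1 / |1 - lambda1^N|, and summation by parts, with
   g_(j+1) - g_j = O(h^(k+2)), a factor 1 / |1 - lambda1| instead of N.  Finally
   c_j = 2 Re z_j controls the end data, and moments together with end data
   control e on the cell.  As |V2| = h / (2k), the last factor in the estimate
   is bounded below, so nothing more is needed about V1 and V2. *)
Require Import Defs.
From mathcomp Require Import ring lra measurable_realfun ess_sup_inf.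

Set Implicit Arguments.
Unset Strict Implicit.
Unset Printing Implicit Defensive.

Local Open Scope classical_set_scope.
Local Open Scope ring_scope.

(** * Weak derivatives and classical regularity *)

(** The constant may not depend on [alpha1], [beta1], [beta2]. This is why the cell estimates are
    made on [0, 1] with derivatives scaled by powers of h: the constants there depend on k alone,
    and the parameters survive only in |1 - lambda1|, |1 - lambda1^N| and the norm of [Q1_]. The
    defects do not involve the unknown w, because the (k+1)-st derivative of e on a cell is minus
    that of u. Hence a shift by one cell costs one more derivative of u and gains a factor h, which
    is what makes summation by parts pay off. That extra derivative, u^(k+2), must be classical and
    bounded pointwise by the norm. A function with a bounded weak derivative is Lipschitz off a null
    set and so has a continuous representative; this loses one order, from k+3 to k+2. Weak
    derivatives are tested against C^1 functions, so the passage rests on explicit C^1 kernels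
    concentrated at Lebesgue points. *)

Lemma is_derive_quadratic (R : realType) (f : R -> R) (x d C : R) :
  (forall h, `|f (h + x) - f x - d * h| <= C * h ^+ 2) -> is_derive x 1 f d.
Proof.
move=> fC.
have cv : h^-1 *: ((f \o shift x) (h *: 1) - f x) @[h --> 0^'] --> d.
  apply/cvgrPdist_le => e e0; near=> h.
  have h0 : h != 0 by near: h; exact: nbhs_dnbhs_neq.
  rewrite /= /GRing.scale /= mulr1 distrC.
  have -> : h^-1 * (f (h + x) - f x) - d = h^-1 * (f (h + x) - f x - d * h).
    by field.
  rewrite normrM normfV ler_pdivrMl ?normr_gt0 //.
  apply: le_trans (fC h) _; rewrite -real_normK ?num_real // expr2 mulrCA.
  (* [|C| + 1] is positive whatever the sign of [C], so it can be divided by. *)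
  rewrite ler_wpM2l //; apply: le_trans (_ : (`|C| + 1) * `|h| <= _).
    by rewrite ler_wpM2r // (le_trans (ler_norm _)) // lerDl.
  rewrite -ler_pdivlMl ?ltr_wpDl //; near: h; apply: dnbhs0_le.
  by rewrite mulr_gt0 // invr_gt0 ltr_wpDl.
by split; [apply/cvg_ex; exists d | exact: cvg_lim cv].
Unshelve. all: by end_near. Qed.

(** The only delicate case is t and h + t of opposite signs, and there the error is still at most
    h^2. So x|x| is C^1, and its translates are the building blocks of all test functions below. *)
Lemma is_derive_mul_norm (R : realType) (t : R) :
  is_derive t 1 (fun x => x * `|x|) (2 * `|t|).
Proof.
apply: (@is_derive_quadratic _ _ _ _ 1) => h; rewrite ler_norml mul1r.
have [t0|t0] := ger0P t; have [s0|s0] := ger0P (h + t).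
- by apply/andP; split; nra.
- apply/andP; split; [nra|].
  have : 0 <= (h + t) ^+ 2 by exact: sqr_ge0.
  nra.
- apply/andP; split; [|nra].
  nra.
- by apply/andP; split; nra.
Qed.

(* A C^1 primitive of the tent, constant outside [-1, 1]. *)
Definition sigmoid (R : realType) (t : R) : R :=
  ((t + 1) * `|t + 1| - 2 * (t * `|t|) + (t - 1) * `|t - 1|) / 4 + 1 / 2.

(** The hat function max(0, 1 - |t|), written as a second difference of the absolute value so that
    it matches the derivative of [sigmoid] term by term. *)
Definition tent (R : realType) (t : R) : R :=
  (`|t + 1| - 2 * `|t| + `|t - 1|) / 2.

Lemma is_derive_affine_comp (R : realType) (f : R -> R) (x c s d : R) :
  is_derive (c + s * x) 1 f d -> is_derive x 1 (fun y => f (c + s * y)) (d * s).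
Proof.
move=> fd; have g : is_derive x 1 (fun y : R => c + s * y) s.
  by apply: is_derive_eq; rewrite /GRing.scale /=; ring.
exact: (@is_derive1_comp _ f (fun y => c + s * y) x _ _ fd g).
Qed.

Lemma is_derive_sigmoid (R : realType) (t : R) :
  is_derive t 1 (@sigmoid R) (tent t).
Proof.
pose q := fun y : R => y * `|y|.
have dq c : is_derive t 1 (fun y : R => q (c + 1 * y)) (2 * `|c + 1 * t| * 1).
  exact/is_derive_affine_comp/is_derive_mul_norm.
have -> : @sigmoid R = fun y => 4^-1 * (q (1 + 1 * y) - 2 * q (0 + 1 * y)
    + q (- 1 + 1 * y)) + 1 / 2.
  apply/funext => y; rewrite /sigmoid /q !mul1r add0r (addrC 1) (addrC (-1)); lra.
have h1 := dq 1; have h0 := dq 0; have hm := dq (-1).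
apply: is_derive_eq; rewrite /tent /GRing.scale /= !mul1r add0r (addrC 1) (addrC (-1)); lra.
Qed.

Lemma sigmoid_le (R : realType) (t : R) : t <= -1 -> sigmoid t = 0.
Proof.
move=> t1; rewrite /sigmoid !ler0_norm; lra.
Qed.

Lemma sigmoid_ge (R : realType) (t : R) : 1 <= t -> sigmoid t = 1.
Proof. by move=> t1; rewrite /sigmoid !ger0_norm; lra. Qed.

Lemma sigmoid_bound (R : realType) (t : R) : 0 <= sigmoid t <= 1.
Proof.
have [t1|t1] := lerP t (-1); first by rewrite sigmoid_le ?lexx ?ler01.
have [t2|t2] := lerP 1 t; first by rewrite sigmoid_ge ?lexx ?ler01.
rewrite /sigmoid (ger0_norm (_ : 0 <= t + 1)); last lra.
rewrite (ler0_norm (_ : t - 1 <= 0)); last lra.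
have [t0|t0] := ger0P t; apply/andP; split; nra.
Qed.

Lemma tent_eq0 (R : realType) (t : R) : 1 <= `|t| -> tent t = 0.
Proof.
rewrite /tent; have [t0|t0] := ger0P t => t1.
- by rewrite !ger0_norm; lra.
- by rewrite !ler0_norm; lra.
Qed.

Lemma tent_bound (R : realType) (t : R) : 0 <= tent t <= 1.
Proof.
have [t1|t1] := lerP 1 `|t|; first by rewrite tent_eq0 ?lexx ?ler01.
move: t1; rewrite ltr_norml /tent => /andP[t1 t2].
rewrite (ger0_norm (_ : 0 <= t + 1)); last lra.
rewrite (ler0_norm (_ : t - 1 <= 0)); last lra.
by have [t0|t0] := ger0P t; apply/andP; split; lra.
Qed.

Lemma continuous_affine (R : realType) (c s : R) : continuous (fun x : R => c + s * x).
Proof.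
move=> x; apply: continuousD; first exact: cvg_cst.
by apply: continuousM; [exact: cvg_cst|exact: cvg_id].
Qed.

Lemma tent_continuous (R : realType) : continuous (@tent R).
Proof.
rewrite /tent => x; apply: cvgM; last exact: cvg_cst.
have h (c : R) : `|y + c| @[y --> x] --> `|x + c|.
  by apply: cvg_norm; apply: cvgD; [exact: cvg_id|exact: cvg_cst].
apply: cvgD; last exact: h.
apply: cvgB; first exact: h.
by apply: cvgM; [exact: cvg_cst|apply: cvg_norm; exact: cvg_id].
Qed.

Lemma bounded_near_le (R : realType) (T : Type) (f : T -> R) (A : set T) (B : R) :
  (forall x, A x -> `|f x| <= B) -> [bounded f x | x in A].
Proof.
move=> fB; exists B; split=> [|M BM x /fB fxB]; first exact: num_real.
exact: le_trans fxB (ltW BM).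
Qed.

Lemma locally_integrable_itv (R : realType) (f : R -> R) (a b : R) :
  locally_integrable setT f ->
  (@lebesgue_measure R).-integrable `[a, b] (EFin \o f).
Proof.
move=> [mf _ fK]; apply/integrableP; split.
  by apply/measurable_EFinP; exact: measurable_funTS.
by apply: fK => //; exact: segment_compact.
Qed.

Lemma locally_integrable_mul_itv (R : realType) (f g : R -> R) (a b : R) :
  locally_integrable setT f -> continuous g ->
  (@lebesgue_measure R).-integrable `[a, b] (EFin \o (fun x => f x * g x)).
Proof.
move=> fi gc; have mg : measurable_fun `[a, b] g.
  by apply: measurable_funTS; exact: continuous_measurable_fun.
have : [bounded g x | x in `[a, b]].
  have /compact_bounded[M [Mr gM]] :=
    continuous_compact (@continuous_subspaceT _ _ `[a, b] _ gc) (@segment_compact R a b).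
  by exists M; split=> // N /gM gN x xab; apply: gN; exists x.
move=> gb; apply: (@integrableMl _ _ _ (@lebesgue_measure R) `[a, b] _ (EFin \o f) g) => //.
exact: locally_integrable_itv.
Qed.

Lemma Rintegral_support (R : realType) (f : R -> R) (A : set R) :
  (forall x, ~ A x -> f x = 0) ->
  \int[@lebesgue_measure R]_x f x = \int[@lebesgue_measure R]_(x in A) f x.
Proof.
move=> f0; rewrite [RHS]Rintegral_mkcond; congr Rintegral.
by apply/funext => x; rewrite patchE; case: ifPn => // /negP xA; apply: f0 => /mem_set.
Qed.

Lemma locally_integrable_shift_itv (R : realType) (f g : R -> R) (c a b : R) :
  locally_integrable setT f -> continuous g ->
  (@lebesgue_measure R).-integrable `[a, b] (EFin \o (fun x => (f x - c) * g x)).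
Proof.
move=> fi gc; apply: locally_integrable_mul_itv => //.
apply: locally_integrableB => //; split; [exact: measurable_cst | exact: openT |].
move=> K _ cK; rewrite integral_cst; last exact: compact_measurable.
rewrite lte_mul_pinfty //; exact: compact_finite_measure.
Qed.

Lemma ball_sub_itv (R : realType) (x e : R) : ball x e `<=` `[x - e, x + e]%classic.
Proof. by rewrite ball_itv => y /=; rewrite !in_itv /= => /andP[/ltW -> /ltW ->]. Qed.

Lemma integrable_ball (R : realType) (f : R -> \bar R) (x e : R) :
  (@lebesgue_measure R).-integrable `[x - e, x + e] f ->
  (@lebesgue_measure R).-integrable (ball x e) f.
Proof.
apply: integrableS; last exact: ball_sub_itv.
- exact: measurable_itv.
- exact: measurable_ball.
Qed.

(** The rescaled kernel lives in the ball of radius e and is at most 1, so the integral is dominated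
    by that of |f - f x| over the ball, whose mean tends to 0 at a Lebesgue point. The kernel is not
    normalised, hence the factor e in the bound. *)
Lemma near_kernel_lebesgue_pt (R : realType) (f rho : R -> R) (x eps : R) :
  locally_integrable setT f -> lebesgue_pt f x -> continuous rho ->
  (forall t, `|rho t| <= 1) -> (forall t, 1 <= `|t| -> rho t = 0) -> 0 < eps ->
  \forall e \near 0^'+,
    `|\int[@lebesgue_measure R]_t ((f t - f x) * rho (- x / e + e^-1 * t))| <= eps * e.
Proof.
move=> fi fx rhoc rho1 rho0 eps0.
have [_ /cvgrPdist_le cv] := (fine_cvgP _ _).1 fx; near=> e.
have e0 : 0 < e by near: e; exact: nbhs_right_gt.
have c : continuous (fun t => rho (- x / e + e^-1 * t)).
  move=> t; apply: (@continuous_comp _ _ _ (fun t => - x / e + e^-1 * t) rho).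
    exact: continuous_affine.
  exact: rhoc.
have mB : measurable (ball x e : set (measurableTypeR R)) by exact: measurable_ball.
have ib : (@lebesgue_measure R).-integrable (ball x e)
    (EFin \o (fun t => (f t - f x) * rho (- x / e + e^-1 * t))).
  apply: integrable_ball.
  exact: locally_integrable_shift_itv.
rewrite (@Rintegral_support _ _ (ball x e)); last first.
  move=> t tx; rewrite rho0 ?mulr0 //.
  have -> : - x / e + e^-1 * t = (t - x) / e by field; rewrite gt_eqF.
  rewrite normrM normfV (gtr0_norm e0) ler_pdivlMr // mul1r leNgt distrC.
  by apply/negP.
have ic : (@lebesgue_measure R).-integrable (ball x e) (EFin \o (fun t => (f t - f x) * cst 1 t)).
  apply: integrable_ball.
  by apply: locally_integrable_shift_itv => //; exact: cst_continuous.
have id : (@lebesgue_measure R).-integrable (ball x e) (EFin \o (fun t => `|f t - f x|)).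
  have := integrable_norm ic; apply: eq_integrable => // t _ /=.
  by rewrite mulr1.
apply: (le_trans (le_normr_Rintegral mB ib)).
apply: (@le_trans _ _ (\int[@lebesgue_measure R]_(t in ball x e) `|f t - f x|)).
  apply: le_Rintegral => //; first exact: integrable_norm.
  by move=> t _; rewrite normrM ler_piMr.
(* [eps / 2], because the mean is over a ball of length 2e. *)
have : `|0 - fine (davg f x e)| <= eps / 2.
  by near: e; apply: cv; rewrite divr_gt0.
rewrite sub0r normrN /davg /iavg lebesgue_measure_ball ?(ltW e0) //.
rewrite inver mulrn_eq0 /=.
rewrite gt_eqF // -[X in (_ * X)%E]fineK; last exact: integrable_fin_num.
have <- : \int[@lebesgue_measure R]_(t in ball x e) `|f t - f x| =
  fine (\int[@lebesgue_measure R]_(t in ball x e) `|((center (f x) \o f) t)%:E|)%E by [].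
rewrite -EFinM /= normrM ger0_norm ?invr_ge0 ?mulrn_wge0 ?(ltW e0) // ler_pdivrMl ?mulrn_wgt0 //.
move/(le_trans (ler_norm _))/le_trans; apply.
rewrite -mulr_natl; lra.
Unshelve. all: by end_near. Qed.

Lemma is_derive_derive1 (R : realType) (f df : R -> R) :
  (forall x : R, is_derive x 1 f (df x)) -> derive1 f = df.
Proof.
by move=> fd; apply/funext => x; rewrite derive1E; exact: (@derive_val _ _ _ _ _ _ _ (fd x)).
Qed.

Lemma test_functionI (R : realType) (f df : R -> R) (M : R) :
  (forall x : R, is_derive x 1 f (df x)) -> continuous df ->
  (forall x, M < `|x| -> f x = 0) -> test_function f.
Proof.
move=> fd dfc f0; split; [by move=> x; exact: ex_derive | | by exists M].
by rewrite (is_derive_derive1 fd).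
Qed.

Lemma continuous_affine_comp (R : realType) (f : R -> R) (c s : R) :
  continuous f -> continuous (fun t => f (c + s * t)).
Proof.
move=> fc t; apply: (@continuous_comp _ _ _ (fun t => c + s * t) f).
  exact: continuous_affine.
exact: fc.
Qed.

(** A C^1 cut-off, equal to 1 for |t| <= 1/4 and to 0 for |t| >= 3/4. It serves where the kernel
    itself must be a test function, which [tent], being only continuous, is not. *)
Definition plateau (R : realType) (t : R) : R := sigmoid (2 + 4 * t) - sigmoid (- 2 + 4 * t).

Lemma is_derive_plateau (R : realType) (t : R) :
  is_derive t 1 (@plateau R) ((tent (2 + 4 * t) - tent (- 2 + 4 * t)) * 4).
Proof.
have d c : is_derive t 1 (fun y : R => sigmoid (c + 4 * y)) (tent (c + 4 * t) * 4).
  exact/is_derive_affine_comp/is_derive_sigmoid.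
have d1 := d 2; have d2 := d (-2); rewrite mulrBl.
exact: is_deriveB.
Qed.

Lemma plateau_eq0 (R : realType) (t : R) : 1 <= `|t| -> plateau t = 0.
Proof.
rewrite /plateau ler_normr => /orP[t1|t1].
  by rewrite !sigmoid_ge ?subrr //; lra.
by rewrite !sigmoid_le ?subrr //; lra.
Qed.

Lemma plateau_bound (R : realType) (t : R) : 0 <= plateau t <= 1.
Proof.
have /andP[h1 h2] := sigmoid_bound (2 + 4 * t).
have /andP[h3 h4] := sigmoid_bound (- 2 + 4 * t).
rewrite /plateau; have [t0|t0] := ger0P t.
  by rewrite (sigmoid_ge (_ : 1 <= 2 + 4 * t)); lra.
by rewrite (sigmoid_le (_ : - 2 + 4 * t <= - 1)); lra.
Qed.

Lemma plateau_eq1 (R : realType) (t : R) : `|t| <= 1 / 4 -> plateau t = 1.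
Proof.
rewrite ler_norml => /andP[h1 h2]; rewrite /plateau sigmoid_ge; last lra.
by rewrite sigmoid_le ?subr0 //; lra.
Qed.

Lemma plateau_continuous (R : realType) : continuous (@plateau R).
Proof.
move=> x; apply: differentiable_continuous; apply/derivable1_diffP.
exact: (@ex_derive _ _ _ _ _ _ _ (is_derive_plateau x)).
Qed.

Lemma affine_support (R : realType) (f : R -> R) (x e t : R) : 0 < e ->
  (forall t, 1 <= `|t| -> f t = 0) -> ~ ball x e t -> f (- x / e + e^-1 * t) = 0.
Proof.
move=> e0 f0 tx; apply: f0.
have -> : - x / e + e^-1 * t = (t - x) / e by field; rewrite gt_eqF.
rewrite normrM normfV (gtr0_norm e0) ler_pdivlMr // mul1r leNgt distrC.
exact/negP.
Qed.

Lemma leb_RintegralZl (R : realType) (D : set R) (f : R -> R) (c : R) :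
  measurable (D : set (measurableTypeR R)) -> (@lebesgue_measure R).-integrable D (EFin \o f) ->
  \int[@lebesgue_measure R]_(t in D) (c * f t) = c * \int[@lebesgue_measure R]_(t in D) f t.
Proof. exact: RintegralZl. Qed.

Lemma leb_RintegralB (R : realType) (D : set R) (f g : R -> R) :
  measurable (D : set (measurableTypeR R)) ->
  (@lebesgue_measure R).-integrable D (EFin \o f) ->
  (@lebesgue_measure R).-integrable D (EFin \o g) ->
  \int[@lebesgue_measure R]_(t in D) (f t - g t) =
  \int[@lebesgue_measure R]_(t in D) f t - \int[@lebesgue_measure R]_(t in D) g t.
Proof. exact: RintegralB. Qed.

Lemma leb_RintegralD (R : realType) (D : set R) (f g : R -> R) :
  measurable (D : set (measurableTypeR R)) ->
  (@lebesgue_measure R).-integrable D (EFin \o f) ->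
  (@lebesgue_measure R).-integrable D (EFin \o g) ->
  \int[@lebesgue_measure R]_(t in D) (f t + g t) =
  \int[@lebesgue_measure R]_(t in D) f t + \int[@lebesgue_measure R]_(t in D) g t.
Proof. exact: RintegralD. Qed.

Lemma leb_measurable_itv (R : realType) (i : interval R) :
  measurable ([set` i] : set (measurableTypeR R)).
Proof. exact: measurable_itv. Qed.

Lemma leb_measurableT (R : realType) : measurable ([set: R] : set (measurableTypeR R)).
Proof. exact: measurableT. Qed.

Lemma ae_sub (R : realType) (P Q : R -> Prop) : (forall x, P x -> Q x) ->
  {ae @lebesgue_measure R, forall x, P x} -> {ae @lebesgue_measure R, forall x, Q x}.
Proof.
exact: (@filterS _ _ (ae_filter_ringOfSetsType (@lebesgue_measure R))).
Qed.

Lemma ae_and (R : realType) (P Q : R -> Prop) :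
  {ae @lebesgue_measure R, forall x, P x} -> {ae @lebesgue_measure R, forall x, Q x} ->
  {ae @lebesgue_measure R, forall x, P x /\ Q x}.
Proof.
exact: (@filterI _ _ (ae_filter_ringOfSetsType (@lebesgue_measure R))).
Qed.

Lemma ae_exists_itv (R : realType) (P : R -> Prop) (a b : R) : a < b ->
  {ae @lebesgue_measure R, forall x, P x} -> exists2 x, a < x < b & P x.
Proof.
move=> ab aeP; apply: contrapT => nP.
have sub : `]a, b[%classic `<=` [set x | ~ P x].
  by move=> x /=; rewrite in_itv /= => xab Px; apply: nP; exists x.
have [A [mA A0 PA]] := aeP.
have : (@lebesgue_measure R `]a, b[ <= 0)%E.
  rewrite -A0; apply: le_measure; rewrite ?inE //.
  exact: subset_trans sub PA.
by rewrite lebesgue_measure_itv /= lte_fin ab -EFinB lee_fin leNgt subr_gt0 ab.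
Qed.

Lemma test_function_plateau (R : realType) (x e : R) : 0 < e ->
  test_function (fun t => plateau (- x / e + e^-1 * t)).
Proof.
move=> e0; pose db := fun t : R => (tent (2 + 4 * t) - tent (- 2 + 4 * t)) * 4.
have dbc : continuous db.
  move=> u; apply: cvgM; last exact: cvg_cst.
  by apply: cvgB; apply: continuous_affine_comp => ?; exact: tent_continuous.
apply: (@test_functionI _ _ (fun t => db (- x / e + e^-1 * t) * e^-1) (`|x| + e)).
- by move=> t; apply: is_derive_affine_comp; exact: is_derive_plateau.
- move=> t; apply: cvgM; last exact: cvg_cst.
  exact: (@continuous_affine_comp _ db).
- move=> t tM; apply: affine_support => //; first exact: plateau_eq0.
  rewrite /ball /= => /ltW xt; move: tM; apply/negP; rewrite -leNgt.
  by rewrite -[t](subKr x) (le_trans (ler_normB _ _)) // lerD2l.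
Qed.

Lemma Rintegral_ge_on_itv (R : realType) (phi : R -> R) (a b c : R) :
  (@lebesgue_measure R).-integrable setT (EFin \o phi) -> (forall t, 0 <= phi t) ->
  a <= b -> (forall t, a <= t <= b -> c <= phi t) ->
  c * (b - a) <= \int[@lebesgue_measure R]_t phi t.
Proof.
move=> phii phi0 ab phic.
have phii' : (@lebesgue_measure R).-integrable `[a, b] (EFin \o phi).
  by apply: integrableS phii.
rewrite -lee_fin /Rintegral fineK; last exact: integrable_fin_num.
apply: (@le_trans _ _ (\int[@lebesgue_measure R]_(t in `[a, b]) (phi t)%:E)%E).
  apply: (@le_trans _ _ (\int[@lebesgue_measure R]_(t in `[a, b]) c%:E)%E).
    rewrite integral_cst //= lebesgue_measure_itv /= lte_fin.
    by case: ltgtP ab => // -> _; rewrite subrr mulr0 mule0.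
  apply: le_integral => //.
    apply: measurable_bounded_integrable => //.
      by have := compact_finite_measure (@segment_compact R a b).
    by apply: (@bounded_near_le _ _ (fun=> c) _ `|c|).
  by move=> t; rewrite inE /= in_itv /= lee_fin => /phic.
apply: ge0_subset_integral => //; first by case/integrableP : phii.
by move=> t _; rewrite lee_fin.
Qed.

Lemma locally_integrable_mul (R : realType) (f g : R -> R) (a b : R) :
  locally_integrable setT f -> continuous g ->
  (forall x, ~ `[a, b]%classic x -> g x = 0) ->
  (@lebesgue_measure R).-integrable setT (EFin \o (fun x => f x * g x)).
Proof.
move=> fi gc g0; have := locally_integrable_mul_itv a b fi gc.
rewrite integrable_mkcond; last exact: measurable_itv.
apply: eq_integrable => //.
move=> t _; rewrite /= patchE; case: ifPn => // /negP tab.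
by rewrite g0 ?mulr0 // => /mem_set.
Qed.

Lemma locally_integrable_cst (R : realType) (c : R) : locally_integrable setT (cst c).
Proof.
split; [exact: measurable_cst | exact: openT |].
move=> K _ cK; rewrite (eq_integral (cst `|c|%:E)) // integral_cst; last exact: compact_measurable.
rewrite lte_mul_pinfty //; exact: compact_finite_measure.
Qed.

(** The fundamental lemma of the calculus of variations. At a Lebesgue point, testing with a
    [plateau] of radius e gives |G x| times the mass of the kernel on one side and o(e) on the
    other; the mass is at least e / 2, since the kernel is 1 on an interval of that length. *)
Lemma integral_test_ae0 (R : realType) (G : R -> R) :
  locally_integrable setT G ->
  (forall phi, test_function phi -> \int[@lebesgue_measure R]_t (G t * phi t) = 0) ->
  {ae @lebesgue_measure R, forall x, G x = 0}.
Proof.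
move=> Gi G0; have := lebesgue_differentiation Gi; apply: ae_sub => x Gx.
apply/eqP; rewrite -normr_le0; apply/ler_addgt0Pr => eps eps0; rewrite add0r.
have b1 t : `|plateau t| <= 1 :> R.
  by have /andP[h1 h2] := plateau_bound t; rewrite ger0_norm.
have K := near_kernel_lebesgue_pt Gi Gx (@plateau_continuous R) b1
  (@plateau_eq0 R) (_ : 0 < eps / 2).
near (0:R)^'+ => e.
have e0 : 0 < e by near: e; exact: nbhs_right_gt.
have : `|\int[@lebesgue_measure R]_t ((G t - G x) * plateau (- x / e + e^-1 * t))| <= eps / 2 * e.
  by near: e; apply: K; rewrite divr_gt0.
set phi := fun t => plateau (- x / e + e^-1 * t).
have phic : continuous phi by apply: continuous_affine_comp; exact: plateau_continuous.
have phi0 t : ~ `[x - e, x + e]%classic t -> phi t = 0.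
  move=> tx; apply: affine_support => //; first exact: plateau_eq0.
  by move=> /ball_sub_itv.
have phii : (@lebesgue_measure R).-integrable setT (EFin \o phi).
  have := locally_integrable_mul (locally_integrable_cst 1) phic phi0.
  by apply: eq_integrable => // t _ /=; rewrite mul1r.
have Gphii := locally_integrable_mul Gi phic phi0.
have Gxi : (@lebesgue_measure R).-integrable setT (EFin \o (fun t => G x * phi t)).
  exact: locally_integrable_mul (locally_integrable_cst _) phic phi0.
have Gz : \int[@lebesgue_measure R]_t (G t * phi t) = 0.
  exact: (G0 phi (test_function_plateau x e0)).
have -> : \int[@lebesgue_measure R]_t ((G t - G x) * phi t) =
    - (G x * \int[@lebesgue_measure R]_t phi t).
  rewrite -(leb_RintegralZl _ (@leb_measurableT R) phii); transitivity (\int[@lebesgue_measure R]_t (G t * phi t) -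
      \int[@lebesgue_measure R]_t (G x * phi t)).
    rewrite -(leb_RintegralB (@leb_measurableT R) Gphii Gxi).
    by apply: eq_Rintegral => t _; rewrite mulrBl.
  by rewrite Gz sub0r.
have phige : 1 * (x + e / 4 - (x - e / 4)) <= \int[@lebesgue_measure R]_t phi t.
  apply: Rintegral_ge_on_itv => //; [|lra|].
    by move=> t; have /andP[] := plateau_bound (- x / e + e^-1 * t).
  move=> t /andP[t1 t2]; rewrite /phi plateau_eq1 //.
  have -> : - x / e + e^-1 * t = (t - x) / e by field; rewrite gt_eqF.
  rewrite normrM normfV (gtr0_norm e0) ler_pdivrMr // ler_norml; apply/andP; split; lra.
rewrite normrN normrM => Gle.
have Ip : 0 < \int[@lebesgue_measure R]_t phi t by apply: lt_le_trans phige; lra.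
rewrite (gtr0_norm Ip) in Gle.
have : `|G x| * (e / 2) <= eps / 2 * e.
  apply: le_trans Gle; rewrite ler_wpM2l //; apply: le_trans phige; lra.
have -> : eps / 2 * e = eps * (e / 2) by field.
by rewrite ler_pM2r // divr_gt0.
Unshelve. all: by end_near. Qed.

(** * The fundamental theorem of calculus for weak derivatives *)

Lemma is_derive_continuous (R : realType) (f : R -> R) (x d : R) :
  is_derive x 1 f d -> {for x, continuous f}.
Proof.
by move=> fd; apply: differentiable_continuous; apply/derivable1_diffP; exact: ex_derive.
Qed.

Lemma FTC2_global (R : realType) (F f : R -> R) (a b : R) : a <= b ->
  continuous f -> (forall x : R, is_derive x 1 F (f x)) ->
  \int[@lebesgue_measure R]_(t in `[a, b]) f t = F b - F a.
Proof.
rewrite le_eqVlt => /predU1P[<- _ _|ab fc Fd].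
  by rewrite set_itv1 Rintegral_set1 subrr.
have Fc x : {for x, continuous F} by exact: is_derive_continuous (Fd x).
rewrite /Rintegral (continuous_FTC2 ab (F := F)) //.
- exact: continuous_subspaceT.
- split; [by move=> x _; exact: ex_derive | |].
    exact/cvg_at_right_filter/Fc.
  exact/cvg_at_left_filter/Fc.
- by move=> x _; rewrite (is_derive_derive1 Fd).
Qed.

Lemma Rintegral_tent (R : realType) (x e : R) : 0 < e ->
  \int[@lebesgue_measure R]_t tent (- x / e + e^-1 * t) = e.
Proof.
move=> e0; rewrite (@Rintegral_support _ _ `[x - e, x + e]%classic); last first.
  move=> t tx; apply: affine_support => //; first exact: tent_eq0.
  by move=> /ball_sub_itv.
have d (t : R) : is_derive t 1 (fun t : R => e * sigmoid (- x / e + e^-1 * t))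
    (tent (- x / e + e^-1 * t)).
  have d (s : R) : is_derive s 1 (fun t : R => sigmoid (- x / e + e^-1 * t))
      (tent (- x / e + e^-1 * s) * e^-1).
    exact/is_derive_affine_comp/is_derive_sigmoid.
  by apply: is_derive_eq; rewrite /GRing.scale /=; field; rewrite gt_eqF.
have c : continuous (fun t : R => tent (- x / e + e^-1 * t)).
  by apply: continuous_affine_comp; exact: tent_continuous.
rewrite (FTC2_global _ c d); last lra.
have -> : - x / e + e^-1 * (x + e) = 1 by field; rewrite gt_eqF.
have -> : - x / e + e^-1 * (x - e) = - 1 by field; rewrite gt_eqF.
by rewrite sigmoid_ge // sigmoid_le // mulr0 subr0 mulr1.
Qed.

(** The rescaled [tent] has mass exactly e, so after division by e the integral of f against it
    differs from f x only by the mean oscillation at x. *)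
Lemma near_tent_lebesgue_pt (R : realType) (f : R -> R) (x eps : R) :
  locally_integrable setT f -> lebesgue_pt f x -> 0 < eps ->
  \forall e \near 0^'+,
    `|e^-1 * \int[@lebesgue_measure R]_t (f t * tent (- x / e + e^-1 * t)) - f x| <= eps.
Proof.
move=> fi fx eps0; have b1 t : `|tent t| <= 1 :> R.
  by have /andP[h1 h2] := tent_bound t; rewrite ger0_norm.
have K := near_kernel_lebesgue_pt fi fx (@tent_continuous R) b1 (@tent_eq0 R) eps0.
near=> e; have e0 : 0 < e by near: e; exact: nbhs_right_gt.
have : `|\int[@lebesgue_measure R]_t ((f t - f x) * tent (- x / e + e^-1 * t))| <= eps * e.
  by near: e.
set phi := fun t => tent (- x / e + e^-1 * t).
have phic : continuous phi by apply: continuous_affine_comp; exact: tent_continuous.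
have phi0 t : ~ `[x - e, x + e]%classic t -> phi t = 0.
  move=> tx; apply: affine_support => //; first exact: tent_eq0.
  by move=> /ball_sub_itv.
have phii : (@lebesgue_measure R).-integrable setT (EFin \o phi).
  have := locally_integrable_mul (locally_integrable_cst 1) phic phi0.
  by apply: eq_integrable => // t _ /=; rewrite mul1r.
have fphii := locally_integrable_mul fi phic phi0.
have fxi : (@lebesgue_measure R).-integrable setT (EFin \o (fun t => f x * phi t)).
  exact: locally_integrable_mul (locally_integrable_cst _) phic phi0.
have -> : \int[@lebesgue_measure R]_t ((f t - f x) * phi t) =
    \int[@lebesgue_measure R]_t (f t * phi t) - f x * e.
  transitivity (\int[@lebesgue_measure R]_t (f t * phi t) -
      \int[@lebesgue_measure R]_t (f x * phi t)).
    rewrite -(leb_RintegralB (@leb_measurableT R) fphii fxi).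
    by apply: eq_Rintegral => t _; rewrite mulrBl.
  by congr (_ - _); rewrite (leb_RintegralZl _ (@leb_measurableT R) phii) Rintegral_tent.
set I := \int[_]_t _ => Ie.
have -> : e^-1 * I - f x = (I - f x * e) / e by field; rewrite gt_eqF.
by rewrite normrM normfV (gtr0_norm e0) ler_pdivrMr.
Unshelve. all: by end_near. Qed.

(* A C^1 regularization of the indicator of [x, y]: its derivative is a tent of
   mass 1 at x minus one at y, so testing against it yields f y - f x at
   Lebesgue points. *)
Definition ramp (R : realType) (x y e t : R) : R :=
  sigmoid (- x / e + e^-1 * t) - sigmoid (- y / e + e^-1 * t).

Lemma is_derive_ramp (R : realType) (x y e t : R) :
  is_derive t 1 (ramp x y e)
    (e^-1 * (tent (- x / e + e^-1 * t) - tent (- y / e + e^-1 * t))).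
Proof.
have d (z : R) : is_derive t 1 (fun t : R => sigmoid (- z / e + e^-1 * t))
    (tent (- z / e + e^-1 * t) * e^-1).
  exact/is_derive_affine_comp/is_derive_sigmoid.
have dx := d x; have dy := d y; rewrite mulrC mulrBl.
exact: is_deriveB.
Qed.

Lemma ramp_bound (R : realType) (x y e t : R) : `|ramp x y e t| <= 1.
Proof.
have /andP[h1 h2] := sigmoid_bound (- x / e + e^-1 * t).
have /andP[h3 h4] := sigmoid_bound (- y / e + e^-1 * t).
by rewrite ler_norml; apply/andP; split; rewrite /ramp; lra.
Qed.

(** Exact equality off the two transition zones means that replacing the ramp by the indicator under
    an integral costs only a set of measure at most 4e. *)
Lemma ramp_eq (R : realType) (x y e t : R) : 0 < e -> x < y ->
  ~ `[x - e, x + e]%classic t -> ~ `[y - e, y + e]%classic t ->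
  ramp x y e t = \1_(`[x, y]%classic) t.
Proof.
move=> e0 xy /= /negP; rewrite in_itv /= negb_and -!ltNge => tx /negP.
rewrite in_itv /= negb_and -!ltNge => ty.
have low z : t < z - e -> sigmoid (- z / e + e^-1 * t) = 0.
  move=> tz; apply: sigmoid_le.
  have -> : - z / e + e^-1 * t = (t - z) / e by field; rewrite gt_eqF.
  by rewrite ler_pdivrMr //; lra.
have high z : z + e < t -> sigmoid (- z / e + e^-1 * t) = 1.
  move=> tz; apply: sigmoid_ge.
  have -> : - z / e + e^-1 * t = (t - z) / e by field; rewrite gt_eqF.
  by rewrite ler_pdivlMr //; lra.
rewrite /ramp indicE; case/orP: tx => tx.
  rewrite !low //; last lra.
  rewrite memNset ?subrr //= in_itv /= => /andP[? ?]; lra.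
rewrite (high x) //; case/orP: ty => ty.
  rewrite low // subr0 mem_set //= in_itv /=; apply/andP; split; lra.
by rewrite high // subrr memNset //= in_itv /= => /andP[? ?]; lra.
Qed.

Lemma test_function_ramp (R : realType) (x y e : R) : 0 < e -> x < y ->
  test_function (ramp x y e).
Proof.
move=> e0 xy; have c (z : R) : continuous (fun t : R => tent (- z / e + e^-1 * t)).
  by apply: continuous_affine_comp; exact: tent_continuous.
apply: (@test_functionI _ _ _ (`|x| + `|y| + e) (is_derive_ramp x y e)).
  by move=> t; apply: cvgM; [exact: cvg_cst|apply: cvgB; exact: c].
have far (z t : R) : `|z| + e < `|t| -> ~ `[z - e, z + e]%classic t.
  move=> zt /=; rewrite in_itv /= => /andP[h1 h2]; move: zt; apply/negP; rewrite -leNgt.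
  rewrite -[t](subrK z) addrC (le_trans (ler_normD _ _)) // lerD2l ler_norml; apply/andP; split; lra.
move=> t xyt; have := normr_ge0 x; have := normr_ge0 y => y0 x0.
rewrite ramp_eq //; [|apply: far; lra|apply: far; lra].
rewrite indicE memNset //= in_itv /= => /andP[xt ty].
move: xyt; apply/negP; rewrite -leNgt; have := ler_norm y; have := ler_norm (- x).
rewrite normrN => h1 h2; rewrite ler_norml; apply/andP; split; lra.
Qed.

Lemma Rintegral_ae_le (R : realType) (f : R -> R) (D : set R) (B : R) :
  measurable (D : set (measurableTypeR R)) -> measurable_fun D f ->
  (@lebesgue_measure R D < +oo)%E ->
  0 <= B -> {ae @lebesgue_measure R, forall x, D x -> `|f x| <= B} ->
  (@lebesgue_measure R).-integrable D (EFin \o f) /\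
  `|\int[@lebesgue_measure R]_(x in D) f x| <= B * fine (@lebesgue_measure R D).
Proof.
move=> mD mf Dfin B0 fB.
have le : (\int[@lebesgue_measure R]_(x in D) `|f x|%:E <= B%:E * @lebesgue_measure R D)%E.
  rewrite -(integral_cst _ mD); apply: ae_ge0_le_integral => //.
  by apply/measurable_EFinP; exact: measurableT_comp.
have fi : (@lebesgue_measure R).-integrable D (EFin \o f).
  apply/integrableP; split; first exact/measurable_EFinP.
  apply: le_lt_trans le _; exact: lte_mul_pinfty.
split => //; apply: (le_trans (le_normr_Rintegral mD fi)).
have muD : @lebesgue_measure R D \is a fin_num by rewrite ge0_fin_numE.
rewrite -lee_fin EFinM (fineK muD) /Rintegral fineK //.
by apply: integrable_fin_num => //; exact: integrable_norm.
Qed.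

(** Test with [ramp]. The side with f tends to f x - f y, as x and y are Lebesgue points; the side
    with g tends to minus the integral over [x, y], as g is bounded and the ramp differs from the
    indicator on a small set. The three errors are at most eps / 3 each. *)
Lemma weak_derivative_FTC (R : realType) (f g : R -> R) (M x y : R) :
  is_weak_derivative f g -> 0 <= M -> {ae @lebesgue_measure R, forall t, `|g t| <= M} ->
  lebesgue_pt f x -> lebesgue_pt f y -> x < y ->
  f y - f x = \int[@lebesgue_measure R]_(t in `[x, y]) g t.
Proof.
move=> [fi gi wd] M0 gM fx fy xy.
apply/eqP; rewrite -subr_eq0 -normr_le0; apply/ler_addgt0Pr => eps eps0; rewrite add0r.
have eps3 : 0 < eps / 3 by rewrite divr_gt0.
have Kx := near_tent_lebesgue_pt fi fx eps3.
have Ky := near_tent_lebesgue_pt fi fy eps3.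
(* The integrands differ by at most 2M on a set of measure at most 4e, whence 8M; the added 1 keeps
   the denominator positive when M = 0. *)
have d0 : 0 < eps / (3 * (8 * M + 1)) by rewrite divr_gt0 ?mulr_gt0 //; lra.
near (0:R)^'+ => e.
have e0 : 0 < e by near: e; exact: nbhs_right_gt.
have ed : e < eps / (3 * (8 * M + 1)) by near: e; exact: nbhs_right_lt.
have Ix : `|e^-1 * \int[@lebesgue_measure R]_t (f t * tent (- x / e + e^-1 * t)) - f x| <= eps / 3.
  by near: e.
have Iy : `|e^-1 * \int[@lebesgue_measure R]_t (f t * tent (- y / e + e^-1 * t)) - f y| <= eps / 3.
  by near: e.
pose ten (z t : R) : R := tent (- z / e + e^-1 * t).
have tenc z : continuous (ten z) by apply: continuous_affine_comp; exact: tent_continuous.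
have ten0 z t : ~ `[z - e, z + e]%classic t -> ten z t = 0.
  move=> tx; apply: affine_support => //; first exact: tent_eq0.
  by move=> /ball_sub_itv.
have ix := locally_integrable_mul fi (@tenc x) (ten0 x).
have iy := locally_integrable_mul fi (@tenc y) (ten0 y).
have tf := test_function_ramp e0 xy.
have := wd _ tf; rewrite (is_derive_derive1 (is_derive_ramp x y e)).
have -> : \int[@lebesgue_measure R]_t (f t * (e^-1 * (ten x t - ten y t))) =
    e^-1 * \int[@lebesgue_measure R]_t (f t * ten x t) -
    e^-1 * \int[@lebesgue_measure R]_t (f t * ten y t).
  rewrite -mulrBr -(leb_RintegralB (@leb_measurableT R) ix iy) -leb_RintegralZl.
  - by apply: eq_Rintegral => t _; ring.
  - exact: leb_measurableT.
  - exact: (integrableB (@leb_measurableT R) ix iy).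
set J := (X in _ = - X -> _) => IJ.
have JG : `|J - \int[@lebesgue_measure R]_(t in `[x, y]) g t| <= eps / 3.
  rewrite Rintegral_mkcond.
  have gxy : (@lebesgue_measure R).-integrable setT (EFin \o (g \_ `[x, y])).
    rewrite -restrict_EFin -integrable_mkcond; last exact: measurable_itv.
    exact: locally_integrable_itv.
  have [M1 M1P] : exists M1 : R, forall t, M1 < `|t| -> ramp x y e t = 0 by case: tf.
  have rc : continuous (ramp x y e).
    by move=> t; exact: is_derive_continuous (is_derive_ramp x y e t).
  have gr : (@lebesgue_measure R).-integrable setT (EFin \o (fun t => g t * ramp x y e t)).
    apply: (@locally_integrable_mul _ _ _ (- M1) M1) => // t /=; rewrite in_itv /= => tM.
    by apply: M1P; rewrite ltNge ler_norml; exact/negP.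
  rewrite -(leb_RintegralB (@leb_measurableT R) gr gxy).
  pose S : set R := `[x - e, x + e] `|` `[y - e, y + e].
  have mS : measurable (S : set (measurableTypeR R)).
    by apply: measurableU; exact: measurable_itv.
  have Sle : (@lebesgue_measure R S <= (4 * e)%:E)%E.
    apply: (le_trans (measureU2 (@lebesgue_measure R) (@leb_measurable_itv R _)
      (@leb_measurable_itv R _))).
    have li (z : R) : (@lebesgue_measure R `[(z - e)%R, (z + e)%R]%classic <= (2 * e)%:E)%E.
      rewrite lebesgue_measure_itv /= lte_fin ifT; last lra.
      by rewrite -EFinB lee_fin; lra.
    by apply: (le_trans (leeD (li x) (li y))); rewrite -EFinD lee_fin; lra.
  rewrite (@Rintegral_support _ _ S); last first.
    move=> t /not_orP[tx ty]; rewrite patchE ramp_eq // indicE.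
    by case: ifP => _; rewrite ?mulr1 ?mulr0 subrr.
  have Sfin : (@lebesgue_measure R S < +oo)%E by exact: le_lt_trans Sle (ltry _).
  have M20 : 0 <= M * 2 by lra.
  have gm : measurable_fun S (fun t => g t * ramp x y e t - (g \_ `[x, y]) t).
    apply: (@measurable_funS _ _ (measurableTypeR R) _ setT) => //.
    by case/integrableP: (integrableB (@leb_measurableT R) gr gxy) => /measurable_EFinP.
  have gle : {ae @lebesgue_measure R, forall t, S t ->
      `|g t * ramp x y e t - (g \_ `[x, y]) t| <= M * 2}.
    apply: ae_sub gM => t gt _; rewrite patchE.
    have -> : (if t \in `[x, y]%classic then g t else point) = g t * \1_(`[x, y]%classic) t.
      by rewrite indicE; case: ifP => _; rewrite ?mulr1 ?mulr0.
    rewrite -mulrBr normrM ler_pM // (le_trans (ler_normB _ _)) //.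
    apply: (@le_trans _ _ (1 + 1)); last lra.
    by rewrite lerD ?ramp_bound // indicE; case: (t \in _) => /=; rewrite ?normr0 ?normr1.
  have [_] := Rintegral_ae_le mS gm Sfin M20 gle.
  move/le_trans; apply; apply: (@le_trans _ _ (M * 2 * (4 * e))).
    by rewrite ler_wpM2l // -lee_fin fineK ?ge0_fin_numE.
  apply: (@le_trans _ _ ((8 * M + 1) * e)); first lra.
  move: ed; rewrite ltr_pdivlMr; last lra.
  by move=> ?; lra.
set G := (X in _ - X); have {}JG : `|J - G| <= eps / 3 := JG; move: IJ JG Ix Iy.
set A := e^-1 * _; set B := e^-1 * _ => IJ.
rewrite !ler_norml => /andP[? ?] /andP[? ?] /andP[? ?]; apply/andP; split; lra.
Unshelve. all: by end_near. Qed.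

Lemma lipschitz_continuous (R : realType) (F : R -> R) (L : R) :
  (forall x y, `|F x - F y| <= L * `|x - y|) -> continuous F.
Proof.
move=> FL x; apply/cvgrPdist_le => e e0; near=> y.
apply: le_trans (FL x y) _; apply: (@le_trans _ _ ((`|L| + 1) * `|x - y|)).
  by rewrite ler_wpM2r // (le_trans (ler_norm _)) // lerDl.
rewrite -ler_pdivlMl ?ltr_wpDl //; near: y.
by apply: cvgr_dist_le; [exact: cvg_id | rewrite mulr_gt0 // invr_gt0 ltr_wpDl].
Unshelve. all: by end_near. Qed.

(* McShane's formula. *)
Lemma lipschitz_extension (R : realType) (S : set R) (f : R -> R) (L : R) :
  0 <= L -> S !=set0 -> (forall x y, S x -> S y -> `|f x - f y| <= L * `|x - y|) ->
  exists2 F : R -> R, continuous F & forall x, S x -> F x = f x.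
Proof.
move=> L0 [p Sp] fL; pose A x := [set f y - L * `|x - y| | y in S].
have A0 x : A x !=set0 by exists (f p - L * `|x - p|); exists p.
have Aub x : ubound (A x) (f p + L * `|x - p|).
  move=> _ [y Sy <-]; have := fL y p Sy Sp; rewrite ler_norml => /andP[_ h].
  have : L * `|y - p| <= L * (`|x - y| + `|x - p|).
    by rewrite ler_wpM2l // (distrC x y) (le_trans _ (ler_normD _ _)) // addrA subrK.
  by rewrite mulrDr; lra.
have supA x : has_sup (A x) by split; [exact: A0 | exists (f p + L * `|x - p|)].
have half x x' : sup (A x) - sup (A x') <= L * `|x - x'|.
  rewrite lerBlDl; apply: ge_sup => // _ [y Sy <-].
  have : f y - L * `|x' - y| <= sup (A x') by apply: (ub_le_sup (supA x').2); exists y.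
  have : L * `|x' - y| <= L * (`|x - x'| + `|x - y|).
    by rewrite ler_wpM2l // (distrC x x') (le_trans _ (ler_normD _ _)) // addrA subrK.
  by rewrite mulrDr; lra.
exists (fun x => sup (A x)).
  apply: (@lipschitz_continuous _ _ L) => x x'; rewrite ler_norml half andbT.
  by rewrite lerNl opprB distrC half.
move=> x Sx; apply/eqP; rewrite eq_le; apply/andP; split.
  apply: ge_sup => // _ [y Sy <-]; have := fL y x Sy Sx.
  by rewrite ler_norml distrC => /andP[_ h]; lra.
by apply: (ub_le_sup (supA x).2); exists x => //; rewrite subrr normr0 mulr0 subr0.
Qed.

(** * Continuous representatives and the Sobolev norm *)

Lemma Lp_normoo_le (R : realType) (D : set R) (f : R -> R) (M : R) : 0 <= M ->
  (Lp_norm D +oo f <= M%:E)%E <-> {ae @lebesgue_measure R, forall x, D x -> `|f x| <= M}.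
Proof.
move=> M0; rewrite /Lp_norm unlock /Lnorm.
(* The norm at [+oo] is an essential supremum guarded by a test that the total measure is positive;
   [T0] settles the test. *)
have T0 : (0 < @lebesgue_measure R [set: R])%E.
  have := @lebesgue_measure_itv R `]-oo, +oo[; rewrite set_itvE /= => ->.
  by rewrite ltry.
rewrite T0; split.
  move=> /ess_supP; apply: ae_sub => x /=; rewrite patchE; case: ifPn => xD /=.
    by rewrite lee_fin.
  by move=> _ Dx; move: xD; rewrite mem_set.
move=> h; apply/ess_supP; apply: ae_sub h => x /=; rewrite patchE; case: ifPn => xD /=.
  by rewrite lee_fin; apply; exact: set_mem.
by rewrite normr0 lee_fin.
Qed.

Lemma in_Linfty_bound (R : realType) (f : R -> R) : in_Linfty f ->
  exists2 M : R, 0 <= M & {ae @lebesgue_measure R, forall x, `|f x| <= M}.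
Proof.
move=> [_]; have := Lnorm_ge0 (@lebesgue_measure R) +oo (EFin \o (f \_ setT)).
rewrite -/(Lp_norm _ _ _); case E : (Lp_norm _ _ _) => [M| |] //; rewrite lee_fin => M0 _.
exists M => //; have /(Lp_normoo_le _ _ M0) : (Lp_norm [set: R] +oo f <= M%:E)%E by rewrite E.
by apply: ae_sub => x; apply.
Qed.

(** [weak_derivative_FTC] makes f Lipschitz on its Lebesgue points, a set of full measure; the
    Lipschitz extension from there is the representative. *)
Lemma weak_derivative_rep (R : realType) (f g : R -> R) :
  is_weak_derivative f g -> in_Linfty g ->
  exists2 F : R -> R, continuous F & {ae @lebesgue_measure R, forall x, f x = F x}.
Proof.
move=> wd gL; have [M M0 gM] := in_Linfty_bound gL.
have [fi gi _] := wd; have Sae := lebesgue_differentiation fi.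
have Slt x y : lebesgue_pt f x -> lebesgue_pt f y -> x < y -> `|f y - f x| <= M * `|y - x|.
  move=> fx fy xy; rewrite (weak_derivative_FTC wd M0 gM fx fy xy).
  have Dfin : (@lebesgue_measure R `[x, y]%classic < +oo)%E.
    exact: (compact_finite_measure (@segment_compact R x y)).
  have mg : measurable_fun `[x, y] g by apply: measurable_funTS; case: gi.
  have [|_] := Rintegral_ae_le (@leb_measurable_itv R `[x, y]) mg Dfin M0.
    by apply: ae_sub gM => t.
  by rewrite lebesgue_measure_itv /= lte_fin xy /= (@gtr0_norm _ (y - x)) ?subr_gt0.
have [p _ Sp] := ae_exists_itv (@ltr01 R) Sae.
have [||F Fc FE] := @lipschitz_extension _ [set x | lebesgue_pt f x] f M M0; first by exists p.
  move=> x y Sx Sy; have [xy|yx|->] := ltgtP x y; last by rewrite !subrr normr0 mulr0.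
    by rewrite distrC (distrC x) Slt.
  exact: Slt.
by exists F => //; apply: ae_sub Sae => x Sx; rewrite FE.
Qed.

Lemma continuous_locally_integrable (R : realType) (f : R -> R) :
  continuous f -> locally_integrable setT f.
Proof.
move=> fc; split; [exact: continuous_measurable_fun | exact: openT |].
move=> K _ cK; have := @continuous_compact_integrable R f K cK.
by case/(_ (continuous_subspaceT fc))/integrableP.
Qed.

(** For continuous f every point is a Lebesgue point, so f is an integral of the continuous g
    everywhere, and the classical theorem differentiates it. *)
Lemma weak_derivative_classical (R : realType) (f g : R -> R) :
  is_weak_derivative f g -> continuous f -> continuous g -> in_Linfty g ->
  forall x : R, is_derive x 1 f (g x).
Proof.
move=> wd fc gc gL x; have [M M0 gM] := in_Linfty_bound gL.
have lp (z : R) : lebesgue_pt f z.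
  apply: (@continuous_lebesgue_pt _ _ _ setT) => //; last exact: fc.
    by split; [exact: openT|].
  exact: continuous_measurable_fun.
(* The base point lies strictly to the left of x, so the formula holds on a whole neighbourhood of
   x. *)
have fE y : x - 1 < y -> f y = f (x - 1) + \int[@lebesgue_measure R]_(t in `[x - 1, y]) g t.
  by move=> xy; rewrite -(weak_derivative_FTC wd M0 gM (lp _) (lp _) xy) addrC subrK.
have [|||Fd FE] := @continuous_FTC1_closed _ g (x - 1) x (x + 1) _ _ _ (gc x).
- lra.
- exact/locally_integrable_itv/continuous_locally_integrable.
- lra.
set F := fun y => \int[@lebesgue_measure R]_(t in `[x - 1, y]) g t in Fd FE.
have dF : is_derive x 1 F (g x) by split => //; rewrite -derive1E.
have d : is_derive x 1 (fun y => f (x - 1) + F y) (g x).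
  by rewrite -[g x]add0r; exact: is_deriveD.
apply: near_eq_is_derive d.
near=> y; rewrite [RHS]fE //; near: y; apply: lt_nbhsr; lra.
Unshelve. all: by end_near. Qed.

Lemma Rintegral_ae_eq (R : realType) (f g : R -> R) (D : set R) :
  measurable (D : set (measurableTypeR R)) ->
  measurable_fun D f -> measurable_fun D g ->
  {ae @lebesgue_measure R, forall x, f x = g x} ->
  \int[@lebesgue_measure R]_(x in D) f x = \int[@lebesgue_measure R]_(x in D) g x.
Proof.
move=> mD mf mg fg; congr fine; apply: ae_eq_integral => //.
- exact/measurable_EFinP.
- exact/measurable_EFinP.
- by apply: ae_sub fg => x -> _.
Qed.

Lemma test_function_continuous (R : realType) (phi : R -> R) :
  test_function phi -> continuous phi.
Proof.
case=> d _ _ x; apply: differentiable_continuous; exact/derivable1_diffP.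
Qed.

Lemma is_weak_derivative_ae (R : realType) (f g f' g' : R -> R) :
  is_weak_derivative f g ->
  locally_integrable setT f' -> locally_integrable setT g' ->
  {ae @lebesgue_measure R, forall x, f x = f' x} ->
  {ae @lebesgue_measure R, forall x, g x = g' x} ->
  is_weak_derivative f' g'.
Proof.
move=> [[mf _ _] [mg _ _] wd] f'i g'i ff' gg'; split => // phi tphi.
have [mf' _ _] := f'i; have [mg' _ _] := g'i.
have mphi : measurable_fun setT phi.
  exact: (continuous_measurable_fun (test_function_continuous tphi)).
have mdphi : measurable_fun setT (derive1 phi).
  by apply: continuous_measurable_fun; case: tphi.
have := wd _ tphi.
rewrite (@Rintegral_ae_eq _ _ (fun x => f' x * derive1 phi x)) //; first last.
- by apply: ae_sub ff' => x ->.
- exact: measurable_funM.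
- exact: measurable_funM.
move=> ->; congr (- _); apply: Rintegral_ae_eq => //; try exact: measurable_funM.
by apply: ae_sub gg' => x ->.
Qed.

Lemma test_function_support (R : realType) (phi : R -> R) : test_function phi ->
  exists M : R, forall x, ~ `[- M, M]%classic x -> phi x = 0.
Proof.
move=> [_ _ [M MP]]; exists M => x /=; rewrite in_itv /= => xM.
by apply: MP; rewrite ltNge ler_norml; exact/negP.
Qed.

Lemma is_weak_derivative_unique (R : realType) (f g g' : R -> R) :
  is_weak_derivative f g -> is_weak_derivative f g' ->
  {ae @lebesgue_measure R, forall x, g x = g' x}.
Proof.
move=> [fi gi wd] [_ g'i wd'].
have := integral_test_ae0 (locally_integrableB gi g'i).
case=> [phi tphi|A [mA A0 AP]]; last first.
  by exists A; split => // x /= gx; apply: AP => /= /eqP; rewrite subr_eq0 => /eqP.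
have [M MP] := test_function_support tphi; have phic := test_function_continuous tphi.
have gphi := locally_integrable_mul gi phic MP.
have g'phi := locally_integrable_mul g'i phic MP.
transitivity (\int[@lebesgue_measure R]_t (g t * phi t) -
    \int[@lebesgue_measure R]_t (g' t * phi t)).
  rewrite -(leb_RintegralB (@leb_measurableT R) gphi g'phi).
  by apply: eq_Rintegral => t _; rewrite mulrBl.
by apply/eqP; rewrite subr_eq0 -eqr_opp -(wd _ tphi) -(wd' _ tphi).
Qed.

Lemma in_Winfty_Linfty (R : realType) (m : nat) (f : R -> R) : in_Winfty m f -> in_Linfty f.
Proof. by case: m => [|m] // []. Qed.

Lemma Linfty_locally_integrable (R : realType) (f : R -> R) :
  in_Linfty f -> locally_integrable setT f.
Proof.
move=> fL; have [M M0 fM] := in_Linfty_bound fL; case: fL => mf _.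
split => //; first exact: openT.
move=> K _ cK; have mK : measurable (K : set (measurableTypeR R)) by exact: compact_measurable.
have mfK : measurable_fun K f by exact: measurable_funTS.
have [|] := Rintegral_ae_le mK mfK (compact_finite_measure cK) M0.
  by apply: ae_sub fM.
by case/integrableP.
Qed.

Lemma in_Linfty_ae (R : realType) (f f' : R -> R) : in_Linfty f ->
  measurable_fun setT f' -> {ae @lebesgue_measure R, forall x, f x = f' x} -> in_Linfty f'.
Proof.
move=> fL mf' ff'; split => //; have [M M0 fM] := in_Linfty_bound fL.
apply: (@le_lt_trans _ _ M%:E); last exact: ltry.
apply/Lp_normoo_le => //; apply: ae_sub (ae_and fM ff') => x [fxM <-] _.
exact: fxM.
Qed.

Lemma in_Winfty_ae (R : realType) (m : nat) (f f' : R -> R) : in_Winfty m f ->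
  measurable_fun setT f' -> {ae @lebesgue_measure R, forall x, f x = f' x} -> in_Winfty m f'.
Proof.
case: m => [|m]; first exact: in_Linfty_ae.
move=> [fL [g [fg gW]]] mf' ff'.
have f'L := in_Linfty_ae fL mf' ff'; split => //; exists g; split => //.
apply: (is_weak_derivative_ae fg) => //; first exact: Linfty_locally_integrable.
  exact/Linfty_locally_integrable/in_Winfty_Linfty/gW.
by apply: (@ae_sub _ (fun x => f x = f' x)) ff'.
Qed.

(** The hypothesis supplies some weak derivative while [weak_derivative] is a choice; uniqueness
    almost everywhere carries the regularity of the former over to the latter. *)
Lemma in_Winfty_weak_derivative (R : realType) (m : nat) (f : R -> R) : in_Winfty m.+1 f ->
  is_weak_derivative f (weak_derivative f) /\ in_Winfty m (weak_derivative f).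
Proof.
move=> [_ [g [fg gW]]].
have fw : is_weak_derivative f (weak_derivative f) by apply: xgetPex; exists g.
split => //; apply: in_Winfty_ae gW _ (is_weak_derivative_unique fg fw).
by case: fw => _ [].
Qed.

Lemma in_Winfty_iter (R : realType) (m i : nat) (f : R -> R) : in_Winfty (i + m) f ->
  in_Winfty m (iter i (@weak_derivative R) f).
Proof.
elim: i m => [//|i IH] m fW; rewrite iterS.
by apply: (in_Winfty_weak_derivative _).2; apply: IH; rewrite addnS -addSn.
Qed.

(** Induction on i. The weak derivative of order i+1 has itself a bounded weak derivative, hence a
    continuous representative G; since the derivative of order i is already continuous, G is its
    classical derivative. Order i+1 thus consumes weak order i+2, which is the bound [i <= m]
    against [m.+1]. *)
Lemma Winfty_classical (R : realType) (m : nat) (u : R -> R) (i : nat) :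
  continuous u -> in_Winfty m.+1 u -> (i <= m)%N ->
  [/\ continuous (derive1n i u),
      {ae @lebesgue_measure R, forall x,
         iter i (@weak_derivative R) u x = derive1n i u x} &
      (0 < i)%N -> forall x : R, is_derive x 1 (derive1n i.-1 u) (derive1n i u x)].
Proof.
move=> uc uW; elim: i => [_|i IH im]; first by split => //; exact: aeW.
have [fc fD _] := IH (ltnW im).
pose D := iter i (@weak_derivative R) u.
have DW : in_Winfty (m - i).+1 D.
  by apply: in_Winfty_iter; rewrite addnS subnKC // ltnW.
have [wd DW1] := in_Winfty_weak_derivative DW.
move: DW1; rewrite -(subnSK im) => DW1.
have [wd2 DW2] := in_Winfty_weak_derivative DW1.
have [G Gc DG] := weak_derivative_rep wd2 (in_Winfty_Linfty DW2).
have GL : in_Linfty G.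
  apply: in_Linfty_ae (in_Winfty_Linfty DW1) _ DG.
  exact: continuous_measurable_fun.
have wG : is_weak_derivative (derive1n i u) G.
  by apply: (is_weak_derivative_ae wd) => //; exact: continuous_locally_integrable.
have dG := weak_derivative_classical wG fc Gc GL.
have E : derive1n i.+1 u = G by rewrite derive1nS (is_derive_derive1 dG).
by rewrite E; split.
Qed.

(** A violation at x persists near x, and the neighbourhood meets [a, b] in a nondegenerate interval
    even when x is an endpoint; such an interval meets every set of full measure. *)
Lemma ae_le_continuous (R : realType) (f : R -> R) (a b M : R) : a < b ->
  continuous f -> {ae @lebesgue_measure R, forall x, `[a, b]%classic x -> `|f x| <= M} ->
  forall x, a <= x <= b -> `|f x| <= M.
Proof.
move=> ab fc fM x /andP[ax xb]; rewrite leNgt; apply/negP => Mx.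
have [d /= d0 dP] : \forall y \near x, M < `|f y|.
  have nc : `|f y| @[y --> x] --> `|f x| by apply: cvg_norm; exact: fc.
  exact: (cvgr_gt _ nc _ Mx).
pose lo := Num.max a (x - d); pose hi := Num.min b (x + d).
have lohi : lo < hi by rewrite lt_min !gt_max; apply/andP; split; apply/andP; split; lra.
have [y /andP[loy yhi]] := ae_exists_itv lohi fM.
move: loy yhi; rewrite gt_max lt_min => /andP[ay xdy] /andP[yb yxd].
have /= := dP y; rewrite ltr_norml => dPy fyM.
have : M < `|f y| by apply: dPy; apply/andP; split; lra.
by apply/negP; rewrite -leNgt; apply: fyM; rewrite /= in_itv /= (ltW ay) (ltW yb).
Qed.

Lemma Winfty_norm_bound (R : realType) (m : nat) (u : R -> R) (a b M : R) (i : nat) (x : R) :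
  a < b -> 0 <= M -> continuous u -> in_Winfty m.+1 u -> (i <= m)%N ->
  (Winfty_norm `[a, b] m.+1 u <= M%:E)%E -> a <= x <= b -> `|derive1n i u x| <= M.
Proof.
move=> ab M0 uc uW im uM; have [fc fD _] := Winfty_classical uc uW im.
apply: (ae_le_continuous ab fc).
have /(Lp_normoo_le _ _ M0) : (Lp_norm `[a, b] +oo (iter i (@weak_derivative R) u) <= M%:E)%E.
  have im2 : (i < m.+2)%N by rewrite ltnS (leq_trans im).
  apply: le_trans uM.
  exact: (le_bigmax _ (fun i : 'I_m.+2 => Lp_norm `[a, b] +oo (iter i (@weak_derivative R) u)) (Ordinal im2)).
by move=> h; apply: ae_sub (ae_and h fD) => y [h1 <-].
Qed.

(** * The reference cell *)

Lemma horner_derivn0 (R : comNzRingType) (p : {poly R}) (n : nat) :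
  p^`(n).[0] = p`_n *+ n`!.
Proof. by rewrite horner_coef0 coef_derivn addn0 ffactnn. Qed.

Lemma derivn_comp_addX (R : comNzRingType) (p : {poly R}) (c : R) (n : nat) :
  (p \Po ('X + c%:P))^`(n) = p^`(n) \Po ('X + c%:P).
Proof.
elim: n => [//|n IH]; rewrite !derivnS IH deriv_comp.
by rewrite derivD derivX derivC addr0 mulr1.
Qed.

(** After the shift t -> t + 1, vanishing at 1 becomes vanishing of low coefficients, which is
    immediate for products t^p (t - 1)^q. *)
Lemma horner_derivn1 (R : comNzRingType) (p : {poly R}) (n : nat) :
  p^`(n).[1] = (p \Po ('X + 1%:P))`_n *+ n`!.
Proof.
by rewrite -horner_derivn0 derivn_comp_addX horner_comp hornerD hornerX hornerC add0r.
Qed.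

Lemma coef0_addXn (R : comNzRingType) (c : R) (n : nat) : (('X + c%:P) ^+ n)`_0 = c ^+ n.
Proof. by rewrite -horner_coef0 horner_exp hornerD hornerX hornerC add0r. Qed.

Lemma coef1_addXn (R : comNzRingType) (c : R) (n : nat) :
  (('X + c%:P) ^+ n)`_1 = c ^+ n.-1 *+ n.
Proof.
have <- : (('X + c%:P) ^+ n)^`()`_0 = (('X + c%:P) ^+ n)`_1 by rewrite coef_deriv mulr1n.
by rewrite deriv_exp derivD derivX derivC addr0 mul1r coefMn coef0_addXn.
Qed.

Lemma continuous_horner (R : realType) (p : {poly R}) : continuous (horner p).
Proof. by move=> x; exact: is_derive_continuous (is_derive_poly p x). Qed.

Lemma continuous_mul (R : realType) (f g : R -> R) :
  continuous f -> continuous g -> continuous (fun x => f x * g x).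
Proof. by move=> fc gc x; apply: cvgM; [exact: fc | exact: gc]. Qed.

Lemma continuous_integrable_itv (R : realType) (f : R -> R) (a b : R) :
  continuous f -> (@lebesgue_measure R).-integrable `[a, b] (EFin \o f).
Proof. by move=> fc; exact/locally_integrable_itv/continuous_locally_integrable. Qed.

Lemma continuous_RintegralD (R : realType) (f g : R -> R) (a b : R) :
  continuous f -> continuous g ->
  \int[@lebesgue_measure R]_(t in `[a, b]) (f t + g t) =
  \int[@lebesgue_measure R]_(t in `[a, b]) f t + \int[@lebesgue_measure R]_(t in `[a, b]) g t.
Proof.
move=> fc gc; apply: leb_RintegralD; first exact: leb_measurable_itv.
  exact: continuous_integrable_itv.
exact: continuous_integrable_itv.
Qed.

Lemma continuous_RintegralZ (R : realType) (f : R -> R) (c a b : R) :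
  continuous f ->
  \int[@lebesgue_measure R]_(t in `[a, b]) (c * f t) =
  c * \int[@lebesgue_measure R]_(t in `[a, b]) f t.
Proof.
move=> fc; apply: leb_RintegralZl; first exact: leb_measurable_itv.
exact: continuous_integrable_itv.
Qed.

Lemma Rintegral01_le (R : realType) (f : R -> R) (B : R) : continuous f ->
  (forall t, 0 <= t <= 1 -> `|f t| <= B) ->
  `|\int[@lebesgue_measure R]_(t in `[0, 1]) f t| <= B.
Proof.
move=> fc fB; have B0 : 0 <= B by apply: le_trans (fB 0 _) => //; rewrite lexx ler01.
have mf : measurable_fun `[(0:R), 1] f.
  by apply: measurable_funTS; exact: continuous_measurable_fun.
have [||_] := Rintegral_ae_le (@leb_measurable_itv R `[0, 1]) mf _ B0.
- exact: (compact_finite_measure (@segment_compact R 0 1)).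
- by apply: aeW => t /=; rewrite in_itv /=; exact: fB.
- by rewrite lebesgue_measure_itv /= lte_fin ltr01 /= subr0 mulr1.
Qed.

Lemma Rintegral01_parts (R : realType) (e e' : R -> R) (p : {poly R}) :
  (forall x : R, is_derive x 1 e (e' x)) -> continuous e' ->
  \int[@lebesgue_measure R]_(t in `[0, 1]) (e' t * p.[t]) =
  e 1 * p.[1] - e 0 * p.[0] - \int[@lebesgue_measure R]_(t in `[0, 1]) (e t * p^`().[t]).
Proof.
move=> ed e'c; have ec : continuous e by move=> x; exact: is_derive_continuous (ed x).
apply/eqP; rewrite -subr_eq opprK; apply/eqP.
have c1 : continuous (fun t => e' t * p.[t]) by apply: continuous_mul => //; exact: continuous_horner.
have c2 : continuous (fun t => e t * p^`().[t]) by apply: continuous_mul => //; exact: continuous_horner.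
rewrite -continuous_RintegralD //.
apply: (@FTC2_global _ (fun t => e t * p.[t])) => //.
  by move=> x; apply: cvgD; [exact: c1 | exact: c2].
move=> x; have d1 := ed x; have d2 := is_derive_poly p x.
have -> : e' x * p.[x] + e x * p^`().[x] = e x *: p^`().[x] + p.[x] *: e' x.
  by rewrite /GRing.scale /=; ring.
exact: (@is_deriveM _ _ e (horner p)).
Qed.

Lemma Rintegral01_parts_iter (R : realType) (n : nat) (e : nat -> R -> R) (p : {poly R}) :
  (forall i, (i < n)%N -> forall x : R, is_derive x 1 (e i) (e i.+1 x)) -> continuous (e n) ->
  \int[@lebesgue_measure R]_(t in `[0, 1]) (e n t * p.[t]) =
  \sum_(i < n) (-1) ^+ i * (e (n.-1 - i)%N 1 * p^`(i).[1] - e (n.-1 - i)%N 0 * p^`(i).[0]) +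
  (-1) ^+ n * \int[@lebesgue_measure R]_(t in `[0, 1]) (e 0%N t * p^`(n).[t]).
Proof.
elim: n p => [|n IH] p ed enc.
  by rewrite big_ord0 expr0 mul1r add0r; apply: eq_Rintegral => t _; rewrite derivn0.
have ec : continuous (e n) by move=> x; exact: is_derive_continuous (ed n (ltnSn n) x).
have ed' i : (i < n)%N -> forall x : R, is_derive x 1 (e i) (e i.+1 x).
  by move=> im; apply: ed; rewrite ltnS ltnW.
rewrite (Rintegral01_parts _ (ed n (ltnSn n)) enc) (IH _ ed' ec).
rewrite big_ord_recl expr0 mul1r derivn0 succnK subn0 opprD addrA exprS mulN1r mulNr -derivSn.
congr (_ - _); congr (_ + _); rewrite -sumrN; apply: eq_bigr => i _.
rewrite lift0 -derivSn exprS mulN1r mulNr.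
by rewrite subnS -subn1 subnAC subn1.
Qed.

Lemma size_derivn (R : nzSemiRingType) (p : {poly R}) (n : nat) : (size p^`(n) <= size p - n)%N.
Proof.
apply/leq_sizeP => i; rewrite leq_subLR => pi.
by rewrite coef_derivn nth_default // mul0rn.
Qed.

(* A p vanishing to order m at both 0 and 1 leaves only two boundary terms at
   each end after m.+2 integrations by parts; the remaining integral is killed
   by the moment conditions. *)
Lemma endpoint_identity (R : realType) (m : nat) (e : nat -> R -> R) (p : {poly R}) :
  (forall i, (i < m.+2)%N -> forall x : R, is_derive x 1 (e i) (e i.+1 x)) ->
  continuous (e m.+2) ->
  (forall q : {poly R}, (size q <= m)%N ->
     \int[@lebesgue_measure R]_(t in `[0, 1]) (e 0%N t * q.[t]) = 0) ->
  (forall i, (i < m)%N -> p`_i = 0) -> (forall i, (i < m)%N -> (p \Po ('X + 1%:P))`_i = 0) ->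
  (size p <= m.+2 + m)%N ->
  (-1) ^+ m * \int[@lebesgue_measure R]_(t in `[0, 1]) (e m.+2 t * p.[t]) =
  e 1%N 1 * p^`(m).[1] - e 1%N 0 * p^`(m).[0]
  - (e 0%N 1 * p^`(m.+1).[1] - e 0%N 0 * p^`(m.+1).[0]).
Proof.
move=> ed ec e0 p0 p1 sp.
rewrite (Rintegral01_parts_iter _ ed ec) e0 ?mulr0 ?addr0; last first.
  by rewrite (leq_trans (size_derivn _ _)) // leq_subLR.
rewrite 2!big_ord_recr /= big1 ?add0r; last first.
  move=> i _; rewrite horner_derivn0 horner_derivn1 p0 // p1 // !mul0rn !mulr0.
  by rewrite subrr mulr0.
rewrite subSnn subnn mulrDr !mulrA -exprD addnn -signr_odd odd_double expr0 mul1r.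
by rewrite exprS mulN1r mulrN -exprD addnn -signr_odd odd_double expr0 mulN1r.
Qed.

Lemma size_exp_XaddC (R : nzRingType) (c : R) (n : nat) : size (('X + c%:P) ^+ n) = n.+1.
Proof. by rewrite -[c]opprK polyCN size_exp_XsubC. Qed.

(** With p = t^m (t - 1)^(m+1) the additional zero at 1 removes the derivative of e there, leaving
    its value at 1 in terms of the data at 0. *)
Lemma endpoint_relation1 (R : realType) (m : nat) (e : nat -> R -> R) :
  (forall i, (i < m.+2)%N -> forall x : R, is_derive x 1 (e i) (e i.+1 x)) ->
  continuous (e m.+2) ->
  (forall q : {poly R}, (size q <= m)%N ->
     \int[@lebesgue_measure R]_(t in `[0, 1]) (e 0%N t * q.[t]) = 0) ->
  m.+1%:R * e 0%N 1 + (-1) ^+ m.+1 * (e 1%N 0 + m.+1%:R ^+ 2 * e 0%N 0) =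
  (-1) ^+ m.+1 / m`!%:R * \int[@lebesgue_measure R]_(t in `[0, 1])
     (e m.+2 t * ('X^m * ('X + (-1)%:P) ^+ m.+1).[t]).
Proof.
move=> ed ec e0; set p := 'X^m * _.
have p1E : p \Po ('X + 1%:P) = ('X + 1%:P) ^+ m * 'X^(m.+1).
  rewrite /p comp_polyM comp_Xn_poly rmorphXn /= comp_polyD comp_polyX comp_polyC.
  by rewrite polyCN addrK.
have h1 : p^`(m).[1] = 0.
  by rewrite horner_derivn1 p1E coefMXn ltnSn mul0rn.
have h2 : p^`(m).[0] = (-1) ^+ m.+1 * m`!%:R.
  by rewrite horner_derivn0 /p coefXnM ltnn subnn coef0_addXn mulr_natr.
have h3 : p^`(m.+1).[1] = m.+1%:R * m`!%:R.
  by rewrite horner_derivn1 p1E coefMXn ltnn subnn coef0_addXn expr1n factS natrM.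
have h4 : p^`(m.+1).[0] = (-1) ^+ m * m.+1%:R * (m.+1%:R * m`!%:R).
  rewrite horner_derivn0 /p coefXnM ltnNge leqnSn subSnn coef1_addXn /=.
  by rewrite factS -(mulr_natr _ (m.+1 * m`!)%N) -(mulr_natr _ m.+1) natrM.
have sp : (size p <= m.+2 + m)%N.
  rewrite (leq_trans (size_polyMleq _ _)) // size_polyXn size_exp_XaddC.
  by rewrite addSn addnC.
have p0 i : (i < m)%N -> p`_i = 0 by move=> im; rewrite coefXnM im.
have p1 i : (i < m)%N -> (p \Po ('X + 1%:P))`_i = 0.
  by move=> im; rewrite p1E coefMXn ltnW.
have := endpoint_identity ed ec e0 p0 p1 sp; rewrite h1 h2 h3 h4.
move: (\int[_]_(_ in _) _) => I; have f0 : m`!%:R != 0 :> R.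
  by rewrite pnatr_eq0 -lt0n fact_gt0.
rewrite (exprS (-1) m); have [->|->] : (-1) ^+ m = 1 :> R \/ (-1) ^+ m = -1 :> R.
  by rewrite -signr_odd; case: (odd m); [right|left].
- by rewrite mul1r => ->; field.
- by rewrite (mulN1r I) => /(congr1 -%R); rewrite opprK => ->; field.
Qed.

(** The mirror choice of p removes the derivative of e at 0 instead. For a polynomial e of degree at
    most m+1 both right-hand sides vanish, and the two relations determine the data at 1 from those
    at 0. *)
Lemma endpoint_relation2 (R : realType) (m : nat) (e : nat -> R -> R) :
  (forall i, (i < m.+2)%N -> forall x : R, is_derive x 1 (e i) (e i.+1 x)) ->
  continuous (e m.+2) ->
  (forall q : {poly R}, (size q <= m)%N ->
     \int[@lebesgue_measure R]_(t in `[0, 1]) (e 0%N t * q.[t]) = 0) ->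
  e 1%N 1 - m.+1%:R ^+ 2 * e 0%N 1 - (-1) ^+ m.+1 * m.+1%:R * e 0%N 0 =
  (-1) ^+ m / m`!%:R * \int[@lebesgue_measure R]_(t in `[0, 1])
     (e m.+2 t * ('X^(m.+1) * ('X + (-1)%:P) ^+ m).[t]).
Proof.
move=> ed ec e0; set p := 'X^(m.+1) * _.
have p1E : p \Po ('X + 1%:P) = ('X + 1%:P) ^+ m.+1 * 'X^m.
  rewrite /p comp_polyM comp_Xn_poly rmorphXn /= comp_polyD comp_polyX comp_polyC.
  by rewrite polyCN addrK.
have h1 : p^`(m).[1] = m`!%:R.
  by rewrite horner_derivn1 p1E coefMXn ltnn subnn coef0_addXn expr1n.
have h2 : p^`(m).[0] = 0.
  by rewrite horner_derivn0 /p coefXnM ltnSn mul0rn.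
have h3 : p^`(m.+1).[1] = m.+1%:R * (m.+1%:R * m`!%:R).
  rewrite horner_derivn1 p1E coefMXn ltnNge leqnSn subSnn coef1_addXn expr1n /=.
  by rewrite factS -(mulr_natr _ (m.+1 * m`!)%N) natrM.
have h4 : p^`(m.+1).[0] = (-1) ^+ m * (m.+1%:R * m`!%:R).
  rewrite horner_derivn0 /p coefXnM ltnn subnn coef0_addXn /=.
  by rewrite factS -(mulr_natr _ (m.+1 * m`!)%N) natrM.
have sp : (size p <= m.+2 + m)%N.
  by rewrite (leq_trans (size_polyMleq _ _)) // size_polyXn size_exp_XaddC addnS.
have p0 i : (i < m)%N -> p`_i = 0 by move=> im; rewrite coefXnM ltnW.
have p1 i : (i < m)%N -> (p \Po ('X + 1%:P))`_i = 0.
  by move=> im; rewrite p1E coefMXn im.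
have := endpoint_identity ed ec e0 p0 p1 sp; rewrite h1 h2 h3 h4.
move: (\int[_]_(_ in _) _) => I; have f0 : m`!%:R != 0 :> R.
  by rewrite pnatr_eq0 -lt0n fact_gt0.
rewrite (exprS (-1) m); have [->|->] : (-1) ^+ m = 1 :> R \/ (-1) ^+ m = -1 :> R.
  by rewrite -signr_odd; case: (odd m); [right|left].
- by rewrite mul1r => ->; field.
- by rewrite (mulN1r I) => /(congr1 -%R); rewrite opprK => ->; field.
Qed.

(** * Control of a polynomial by its moments and end data *)

Lemma poly_eq0_on_itv (R : realType) (p : {poly R}) :
  (forall t, 0 <= t <= 1 -> p.[t] = 0) -> p = 0.
Proof.
move=> p0; pose rs := [seq (i.+1%:R)^-1 : R | i <- iota 0 (size p)].
apply: (@roots_geq_poly_eq0 _ p rs); last by rewrite size_map size_iota.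
  apply/allP => _ /mapP[i _ ->]; rewrite /root p0 // invr_ge0 ler0n /=.
  by rewrite invf_le1 ?ltr0n // ler1n.
rewrite map_inj_uniq ?iota_uniq // => i j /invr_inj /eqP.
by rewrite eqr_nat eqSS => /eqP.
Qed.

Lemma Rintegral01_poly_eq0 (R : realType) (p : {poly R}) :
  (forall t, 0 <= p.[t]) -> \int[@lebesgue_measure R]_(t in `[0, 1]) p.[t] = 0 -> p = 0.
Proof.
move=> p0 Ip; apply: poly_eq0_on_itv => t t01; apply/eqP; rewrite -normr_le0.
have pc := @continuous_horner R p; apply: (ae_le_continuous ltr01 pc) t01 => {t}.
have pi := continuous_integrable_itv (0 : R) 1 pc.
have mp : measurable_fun `[(0 : R), 1] (EFin \o horner p) by case/integrableP: pi.
have : (\int[@lebesgue_measure R]_(t in `[0%R, 1%R]) `|(EFin \o horner p) t| = 0)%E.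
  transitivity (\int[@lebesgue_measure R]_(t in `[0%R, 1%R]) (p.[t])%:E)%E.
    by apply: eq_integral => t _; rewrite gee0_abs // lee_fin.
  rewrite -[LHS]fineK; first by congr EFin.
  exact: (integrable_fin_num (@leb_measurable_itv R _) pi).
move/(ae_eq_integral_abs _ (@leb_measurable_itv R _) mp).
by apply: ae_sub => t h t01; have [->] := h t01; rewrite normr0.
Qed.

Lemma Rintegral01_polyD (R : realType) (p q : {poly R}) :
  \int[@lebesgue_measure R]_(t in `[0, 1]) (p + q).[t] =
  \int[@lebesgue_measure R]_(t in `[0, 1]) p.[t] + \int[@lebesgue_measure R]_(t in `[0, 1]) q.[t].
Proof.
rewrite -continuous_RintegralD; [|exact: continuous_horner..].
by apply: eq_Rintegral => t _; rewrite hornerD.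
Qed.

Lemma Rintegral01_polyZ (R : realType) (p : {poly R}) (c : R) :
  \int[@lebesgue_measure R]_(t in `[0, 1]) (c *: p).[t] =
  c * \int[@lebesgue_measure R]_(t in `[0, 1]) p.[t].
Proof.
rewrite -continuous_RintegralZ; last exact: continuous_horner.
by apply: eq_Rintegral => t _; rewrite hornerZ.
Qed.

Lemma Rintegral01_poly_sum (R : realType) (I : finType) (P : pred I) (F : I -> {poly R}) :
  \int[@lebesgue_measure R]_(t in `[0, 1]) (\sum_(i | P i) F i).[t] =
  \sum_(i | P i) \int[@lebesgue_measure R]_(t in `[0, 1]) (F i).[t].
Proof.
apply: (big_morph (fun p : {poly R} => \int[@lebesgue_measure R]_(t in `[0, 1]) p.[t])).
  exact: Rintegral01_polyD.
by rewrite -(scale0r (0 : {poly R})) Rintegral01_polyZ mul0r.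
Qed.

(* Unisolvent data on polynomials of degree at most m.+1: the moments of order
   less than m, and the value and derivative at 1. *)
Definition moment (R : realType) (m j : nat) (p : {poly R}) : R :=
  if (j < m)%N then \int[@lebesgue_measure R]_(t in `[0, 1]) (p * 'X^j).[t]
  else if j == m then p.[1] else p^`().[1].

Lemma moment_sum (R : realType) (m j n : nat) (c : 'I_n -> R) :
  moment m j (\sum_(i < n) c i *: 'X^i) = \sum_(i < n) c i * moment m j 'X^i.
Proof.
rewrite /moment; case: ifP => _.
  rewrite mulr_suml Rintegral01_poly_sum; apply: eq_bigr => i _.
  by rewrite -scalerAl Rintegral01_polyZ.
case: ifP => _.
  by rewrite horner_sum; apply: eq_bigr => i _; rewrite hornerZ.
by rewrite raddf_sum horner_sum; apply: eq_bigr => i _; rewrite /= derivZ hornerZ.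
Qed.

(** The data at 1 give p = (t - 1)^2 q with q among the moment test polynomials; testing with q
    itself makes the integral of (t - 1)^2 q^2 vanish. *)
Lemma moment_eq0 (R : realType) (m : nat) (p : {poly R}) : (size p <= m.+2)%N ->
  (forall j, (j < m.+2)%N -> moment m j p = 0) -> p = 0.
Proof.
move=> sp pm; have p1 : root p 1.
  by have := pm m; rewrite /moment ltnn eqxx => pm1; apply/eqP/pm1; rewrite ltnW.
have /factor_theorem[p' pE] := p1.
have dp1 : root p' 1.
  have := pm m.+1 (ltnSn _); rewrite /moment ltnNge leqnSn /= gtn_eqF //=.
  rewrite pE derivM derivXsubC !hornerE subrr mulr0 add0r => p'0; exact/eqP.
have /factor_theorem[q qE] := dp1.
have [q0|q0] := eqVneq q 0; first by rewrite pE qE q0 !mul0r.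
have pqE : p = q * ('X - 1%:P) ^+ 2 by rewrite pE qE -mulrA.
have sq : (size q <= m)%N.
  move: sp; rewrite pqE size_proper_mul ?size_exp_XsubC.
    by rewrite addn3.
  by rewrite lead_coef_exp lead_coefXsubC expr1n mulr1 lead_coef_eq0.
have : p * q = 0.
  apply: Rintegral01_poly_eq0.
    move=> t; rewrite pqE mulrAC !hornerM -expr2 -exprMn; exact: sqr_ge0.
  rewrite -[q in p * q]coefK poly_def mulr_sumr Rintegral01_poly_sum big1 // => i _.
  rewrite -scalerAr Rintegral01_polyZ; have im : (i < m)%N by apply: leq_trans sq.
  have := pm i; rewrite /moment im => -> //; first by rewrite mulr0.
  by rewrite ltnW // ltnW.
by move/eqP; rewrite mulf_eq0 (negbTE q0) orbF => /eqP.
Qed.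

(** By unisolvence the matrix of the functionals on monomials is invertible. Its inverse depends on
    m alone and bounds the coefficients, so the sum of the moduli of its entries is an admissible
    constant. *)
Lemma moment_bound (R : realType) (m : nat) :
  exists2 C : R, 0 < C & forall (p : {poly R}) (B : R), (size p <= m.+2)%N ->
    (forall j, (j < m.+2)%N -> `|moment m j p| <= B) ->
    forall t, 0 <= t <= 1 -> `|p.[t]| <= C * B.
Proof.
pose A : 'M[R]_m.+2 := \matrix_(i, j) moment m j 'X^i.
have momE (p : {poly R}) (j : 'I_m.+2) : (size p <= m.+2)%N ->
    moment m j p = \sum_(i < m.+2) p`_i * A i j.
  move=> sp; rewrite -[in LHS](take_poly_id sp) /take_poly poly_def moment_sum.
  by apply: eq_bigr => i _; rewrite mxE.
have Au : A \in unitmx.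
  rewrite -row_free_unit -kermx_eq0; apply/rowV0P => v /sub_kermxP vA.
  pose p := \poly_(i < m.+2) v 0 (inord i).
  have pv (i : 'I_m.+2) : p`_i = v 0 i by rewrite coef_poly ltn_ord inord_val.
  have sp : (size p <= m.+2)%N by exact: size_poly.
  have p0 : p = 0.
    apply: (moment_eq0 sp) => j jm; rewrite (momE p (Ordinal jm) sp).
    transitivity ((v *m A) 0 (Ordinal jm)); last by rewrite vA mxE.
    by rewrite mxE; apply: eq_bigr => i _; rewrite pv.
  by apply/rowP => i; rewrite -pv p0 coef0 mxE.
pose K := \sum_(i < m.+2) \sum_(j < m.+2) `|invmx A j i|.
have K0 : 0 <= K by apply: sumr_ge0 => i _; apply: sumr_ge0.
exists (K + 1) => [|p B sp pB t /andP[t0 t1]]; first by rewrite ltr_wpDl.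
have B0 : 0 <= B by apply: le_trans (pB 0%N _).
have coefE (i : 'I_m.+2) : p`_i = \sum_(j < m.+2) moment m j p * invmx A j i.
  pose v : 'rV[R]_m.+2 := \row_i p`_i.
  have -> : p`_i = (v *m A *m invmx A) 0 i by rewrite -mulmxA mulmxV // mulmx1 mxE.
  rewrite [LHS]mxE; apply: eq_bigr => j _; congr (_ * _).
  by rewrite mxE momE //; apply: eq_bigr => l _; rewrite mxE.
have -> : p.[t] = \sum_(i < m.+2) p`_i * t ^+ i.
  by rewrite (horner_coef_wide _ sp).
apply: (@le_trans _ _ (K * B)); last by rewrite ler_wpM2r // lerDl.
apply: (le_trans (ler_norm_sum _ _ _)); rewrite mulr_suml; apply: ler_sum => i _.
rewrite normrM; apply: (@le_trans _ _ (`|p`_i| * 1)).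
  by rewrite ler_wpM2l // normrX exprn_ile1 // ger0_norm.
rewrite mulr1 coefE (le_trans (ler_norm_sum _ _ _)) // mulr_suml; apply: ler_sum => j _.
by rewrite normrM mulrC ler_wpM2l // pB.
Qed.

Lemma derivative_bound01 (R : realType) (f df : R -> R) (B t : R) :
  (forall x : R, is_derive x 1 f (df x)) -> f 0 = 0 ->
  (forall t, 0 <= t <= 1 -> `|df t| <= B) -> 0 <= t <= 1 -> `|f t| <= B.
Proof.
move=> fd f0 dfB /andP[t0 t1].
have [|c] := MVT_segment t0 (fun x _ => fd x).
  by apply: continuous_subspaceT => x; exact: is_derive_continuous (fd x).
rewrite in_itv /= f0 !subr0 => /andP[c0 ct] ->; rewrite normrM (ger0_norm t0).
have dB : `|df c| <= B by rewrite dfB // c0 (le_trans ct).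
by rewrite (le_trans _ dB) // ler_piMr.
Qed.

(** Descending induction from order n: on an interval of length 1, passing to a primitive that
    vanishes at 0 does not increase the bound, so the same B serves all orders. *)
Lemma derivative_bound01_iter (R : realType) (n : nat) (r : nat -> R -> R) (B : R) :
  (forall i, (i < n)%N -> forall x : R, is_derive x 1 (r i) (r i.+1 x)) ->
  (forall i, (i < n)%N -> r i 0 = 0) ->
  (forall t, 0 <= t <= 1 -> `|r n t| <= B) ->
  forall i, (i <= n)%N -> forall t, 0 <= t <= 1 -> `|r i t| <= B.
Proof.
move=> rd r0 rB i i_n; rewrite -(subKn i_n); elim: (n - i)%N (leq_subr i n) => [|j IH] jn.
  by rewrite subn0.
have jn' : (n - j.+1 < n)%N by rewrite subnSK // leq_subr.
move=> t; apply: (derivative_bound01 (rd _ jn') (r0 _ jn')).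
by rewrite subnSK //; apply: IH; rewrite ltnW.
Qed.

Definition taylor_poly (R : realType) (n : nat) (v : nat -> R -> R) : {poly R} :=
  \poly_(i < n) (v i 0 / i`!%:R).

Lemma taylor_remainder (R : realType) (n : nat) (v : nat -> R -> R) (B : R) :
  (forall i, (i < n)%N -> forall x : R, is_derive x 1 (v i) (v i.+1 x)) ->
  (forall t, 0 <= t <= 1 -> `|v n t| <= B) ->
  forall i, (i <= n)%N -> forall t, 0 <= t <= 1 ->
    `|v i t - (taylor_poly n v)^`(i).[t]| <= B.
Proof.
move=> vd vB; pose T := taylor_poly n v.
apply: (@derivative_bound01_iter _ _ (fun i t => v i t - T^`(i).[t])).
- move=> i i_n x; have d1 := vd i i_n x; have d2 := is_derive_poly T^`(i) x.
  by rewrite derivnS; exact: is_deriveB.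
- move=> i i_n; rewrite horner_derivn0 coef_poly i_n -[X in _ - X]mulr_natr divfK ?subrr //.
- by move=> t t01; rewrite derivn_poly0 ?size_poly // horner0 subr0 vB.
Qed.

(** Let T be the Taylor polynomial of v at 0. The end data of S - T are at most 2B by the triangle
    inequality, and its moments are those of v - T because S - v has none. So [moment_bound]
    controls S - T, and the Taylor remainder does the rest. *)
Lemma cell_bound (R : realType) (m : nat) :
  exists2 C : R, 0 < C & forall (S : {poly R}) (v : nat -> R -> R) (B : R),
    (size S <= m.+2)%N ->
    (forall i, (i < m.+2)%N -> forall x : R, is_derive x 1 (v i) (v i.+1 x)) ->
    (forall t, 0 <= t <= 1 -> `|v m.+2 t| <= B) ->
    (forall q : {poly R}, (size q <= m)%N ->
      \int[@lebesgue_measure R]_(t in `[0, 1]) ((S.[t] - v 0%N t) * q.[t]) = 0) ->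
    `|S.[1] - v 0%N 1| <= B -> `|S^`().[1] - v 1%N 1| <= B ->
    forall t, 0 <= t <= 1 -> `|S.[t] - v 0%N t| <= C * B.
Proof.
have [C C0 Cb] := moment_bound R m; exists (2 * C + 1) => [|S v B sS vd vB mom S1 dS1 t t01].
  by rewrite addr_gt0 // mulr_gt0.
pose T := taylor_poly m.+2 v.
have rem := taylor_remainder vd vB.
have B0 : 0 <= B by apply: le_trans S1.
have o01 : 0 <= (1 : R) <= 1 by rewrite ler01 lexx.
have r0 s : 0 <= s <= 1 -> `|v 0%N s - T.[s]| <= B by move=> s01; exact: (rem 0%N).
have r1 s : 0 <= s <= 1 -> `|v 1%N s - T^`().[s]| <= B.
  by move=> s01; have := rem 1%N isT s s01; rewrite derivn1.
have vc : continuous (v 0%N) by move=> x; exact: is_derive_continuous (vd 0%N isT x).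
have sp : (size (S - T)%R <= m.+2)%N.
  by rewrite (leq_trans (size_polyD _ _)) // size_polyN geq_max sS size_poly.
have split2 (x y z : R) : `|x - y| <= B -> `|y - z| <= B -> `|x - z| <= 2 * B.
  move=> xy yz; rewrite (le_trans (ler_distD y _ _)) //; lra.
have mB j : (j < m.+2)%N -> `|moment m j (S - T)| <= 2 * B.
  rewrite ltnS leq_eqVlt => /predU1P[->|].
    rewrite /moment ltnNge leqnSn /= gtn_eqF // derivB !hornerE.
    exact: split2 dS1 (r1 1 o01).
  rewrite ltnS leq_eqVlt => /predU1P[->|jm].
    by rewrite /moment ltnn eqxx !hornerE; exact: split2 S1 (r0 1 o01).
  have e0 := mom 'X^j; rewrite size_polyXn in e0.
  have rc : continuous (fun s => (v 0%N s - T.[s]) * ('X^j).[s]).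
    apply: continuous_mul; last exact: continuous_horner.
    by move=> x; apply: cvgB; [exact: vc | exact: continuous_horner].
  have ec : continuous (fun s => (S.[s] - v 0%N s) * ('X^j).[s]).
    apply: continuous_mul; last exact: continuous_horner.
    by move=> x; apply: cvgB; [exact: continuous_horner | exact: vc].
  rewrite /moment jm.
  have -> : \int[@lebesgue_measure R]_(s in `[0, 1]) ((S - T) * 'X^j).[s] =
      \int[@lebesgue_measure R]_(s in `[0, 1]) ((v 0%N s - T.[s]) * ('X^j).[s]).
    rewrite -[RHS]add0r -[X in _ = X + _](e0 jm) -continuous_RintegralD //.
    by apply: eq_Rintegral => s _; rewrite !hornerE; ring.
  apply: (@le_trans _ _ B); last lra.
  apply: Rintegral01_le => // s s01; rewrite normrM hornerXn.
  rewrite -[B]mulr1 ler_pM // ?r0 //; case/andP: s01 => s0 s1.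
  by rewrite normrX exprn_ile1 // ger0_norm.
have pB := Cb _ _ sp mB t t01.
rewrite (le_trans (ler_distD T.[t] _ _)) //; have := r0 t t01.
rewrite hornerD hornerN in pB; rewrite (distrC (v _ _)) => h.
have -> : (2 * C + 1) * B = C * (2 * B) + B by ring.
exact: lerD.
Qed.

Lemma is_derive_affine (R : realType) (c s x : R) :
  is_derive x 1 (fun y : R => c + s * y) s.
Proof. by apply: is_derive_eq; rewrite /GRing.scale /=; ring. Qed.

(** * The cellwise system *)

Lemma Rintegral_affine (R : realType) (G : R -> R) (c h : R) : 0 < h -> continuous G ->
  \int[@lebesgue_measure R]_(x in `[c, c + h]) G x =
  h * \int[@lebesgue_measure R]_(t in `[0, 1]) G (c + h * t).
Proof.
move=> h0 Gc; pose F (t : R) := c + h * t.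
have dF : derive1 F = cst h by apply: is_derive_derive1 => x; exact: is_derive_affine.
have Fc : continuous F by exact: continuous_affine.
have Gac : continuous (fun t => G (c + h * t)) by exact: continuous_affine_comp.
rewrite -continuous_RintegralZ //.
have E := @integration_by_substitution_increasing R F G 0 1 ler01.
have F0 : F 0 = c by rewrite /F mulr0 addr0.
have F1 : F 1 = c + h by rewrite /F mulr1.
rewrite dF F0 F1 in E; rewrite /Rintegral E.
- by congr fine; apply: eq_integral => t _; rewrite mulrC.
- by move=> x y _ _ xy; rewrite /F ltrD2l ltr_pM2l.
- by move=> x _; exact: cst_continuous.
- exact: is_cvg_cst.
- exact: is_cvg_cst.
- split; first by move=> x _; exact: (@ex_derive _ _ _ _ _ _ _ (is_derive_affine c h x)).
    exact/cvg_at_right_filter/Fc.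
  exact/cvg_at_left_filter/Fc.
- exact: continuous_subspaceT.
Qed.

Lemma lim_left_eq (R : realType) (w f : R -> R) (c d : R) : c < d ->
  (forall x, c < x < d -> w x = f x) -> {for d, continuous f} ->
  lim (w x @[x --> d^'-]) = f d.
Proof.
move=> cd wf fc; apply: cvg_lim => //.
apply: cvg_trans (cvg_at_left_filter fc); apply: near_eq_cvg; near=> x.
by rewrite wf //; apply/andP; split; near: x; [exact: nbhs_left_gt | exact: nbhs_left_lt].
Unshelve. all: by end_near. Qed.

Lemma lim_right_eq (R : realType) (w f : R -> R) (c d : R) : c < d ->
  (forall x, c < x < d -> w x = f x) -> {for c, continuous f} ->
  lim (w x @[x --> c^'+]) = f c.
Proof.
move=> cd wf fc; apply: cvg_lim => //.
apply: cvg_trans (cvg_at_right_filter fc); apply: near_eq_cvg; near=> x.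
by rewrite wf //; apply/andP; split; near: x; [exact: nbhs_right_gt | exact: nbhs_right_lt].
Unshelve. all: by end_near. Qed.

Lemma derive1_eq_poly (R : realType) (w : R -> R) (p : {poly R}) (c d : R) :
  (forall x, c < x < d -> w x = p.[x]) ->
  forall x, c < x < d -> derive1 w x = p^`().[x].
Proof.
move=> wp x /andP[cx xd]; rewrite derive1E.
have -> : 'D_1 w x = 'D_1 (horner p) x.
  apply: near_eq_derive.
  by near=> y; rewrite wp //; apply/andP; split; near: y; [exact: lt_nbhsr | exact: lt_nbhsl].
exact: (@derive_val _ _ _ _ _ _ _ (is_derive_poly p x)).
Unshelve. all: by end_near. Qed.

Lemma Rintegral_oo_cc (R : realType) (f : R -> R) (c d : R) : continuous f ->
  \int[@lebesgue_measure R]_(x in `]c, d[) f x = \int[@lebesgue_measure R]_(x in `[c, d]) f x.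
Proof.
move=> fc; have fi := continuous_integrable_itv c d fc.
have sub (i : interval R) : [set` i] `<=` `[c, d]%classic ->
    (@lebesgue_measure R).-integrable [set` i] (EFin \o f).
  by move=> ic; apply: integrableS fi; [exact: measurable_itv|exact: measurable_itv|exact: ic].
rewrite Rintegral_itv_obnd_cbnd; last by apply: sub; exact: subset_itv_oo_cc.
rewrite Rintegral_itv_bndo_bndc //; apply: sub; exact: subset_itv_co_cc.
Qed.

Lemma horner_affine (R : comNzRingType) (p : {poly R}) (c s t : R) :
  (p \Po (s *: 'X + c%:P)).[t] = p.[c + s * t].
Proof. by rewrite horner_comp hornerD hornerZ hornerX hornerC addrC. Qed.

Lemma deriv_affine (R : comNzRingType) (p : {poly R}) (c s : R) :
  (p \Po (s *: 'X + c%:P))^`() = s *: (p^`() \Po (s *: 'X + c%:P)).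
Proof.
by rewrite deriv_comp derivD derivZ derivX derivC addr0 alg_polyC mulrC mul_polyC.
Qed.

Lemma size_affine_le (R : comNzRingType) (p : {poly R}) (c s : R) (n : nat) :
  (size p <= n)%N -> (size (p \Po (s *: 'X + c%:P)) <= n)%N.
Proof.
move=> pn; have [->|p0] := eqVneq p 0; first by rewrite comp_poly0 size_poly0.
have : (size (p \Po (s *: 'X + c%:P)) <= (size p).-1.+1)%N.
  rewrite (leq_trans (size_comp_poly_leq _ _)) // ltnS -{2}(muln1 (size p).-1) leq_mul //.
  rewrite -subn1 leq_subLR (leq_trans (size_polyD _ _)) // geq_max.
  rewrite (leq_trans (size_scale_leq _ _)) ?size_polyX //=.
  by rewrite (leq_trans (size_polyC_leq1 _)).
by rewrite prednK ?size_poly_gt0 // => /leq_trans; apply.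
Qed.

(** In the coordinate t = (x - node) / h the traces become values at 0 and 1, and each derivative
    costs a factor 1 / h. From here on w is replaced by polynomials, so its values at the nodes
    disappear. *)
Lemma Pstar_cells (R : realType) (a b : R) (N m : nat) (alpha1 beta1 beta2 : R)
    (u u' w : R -> R) :
  a < b -> (0 < N)%N -> (forall x : R, is_derive x 1 u (u' x)) ->
  is_Pstar a b N m.+1 alpha1 beta1 beta2 u w ->
  let h := meshsize a b N in
  exists W : nat -> {poly R}, forall j, (j < N)%N ->
  [/\ (size (W j) <= m.+2)%N,
      forall x, node a b N j < x < node a b N j.+1 -> w x = (W j).[(x - node a b N j) / h],
      forall q : {poly R}, (size q <= m)%N ->
        \int[@lebesgue_measure R]_(t in `[0, 1])
          (((W j).[t] - u (node a b N j + h * t)) * q.[t]) = 0,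
      ((W (j.+1 %% N)%N).[0] + (W j).[1]) / 2 - alpha1 * ((W (j.+1 %% N)%N).[0] - (W j).[1])
        + beta2 * ((W (j.+1 %% N)%N)^`().[0] / h - (W j)^`().[1] / h) = u (node a b N j.+1) &
      ((W (j.+1 %% N)%N)^`().[0] / h + (W j)^`().[1] / h) / 2
        + alpha1 * ((W (j.+1 %% N)%N)^`().[0] / h - (W j)^`().[1] / h)
        + beta1 * ((W (j.+1 %% N)%N).[0] - (W j).[1]) = u' (node a b N j.+1)].
Proof.
case: N => // N ab _ ud [wV wP] h; set nd := node a b N.+1.
have h0 : 0 < h by rewrite /h /meshsize divr_gt0 ?subr_gt0 // ltr0n.
have hN : h != 0 by rewrite gt_eqF.
have ndS j : nd j.+1 = nd j + h by rewrite /nd /node -natr1 mulrDl mul1r addrA.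
have ndlt j : nd j < nd j.+1 by rewrite ndS ltrDl.
have [q qP] := choice wV.
have uc : continuous u by move=> x; exact: is_derive_continuous (ud x).
have qw (j : 'I_N.+1) x : nd j < x < nd j.+1 -> w x = (q j).[x].
  by move=> xj; apply: (qP j).2; rewrite /cell /= in_itv.
have dqw (j : 'I_N.+1) x : nd j < x < nd j.+1 -> derive1 w x = (q j)^`().[x].
  exact: derive1_eq_poly (qw j) x.
pose W (j : nat) : {poly R} := q (inord j) \Po (h *: 'X + (nd j)%:P).
have WE j t : (W j).[t] = (q (inord j)).[nd j + h * t].
  by rewrite /W horner_affine.
have dWE j t : (W j)^`().[t] = h * (q (inord j))^`().[nd j + h * t].
  by rewrite /W deriv_affine hornerZ horner_affine.
have cont (p : {poly R}) (x : R) : {for x, continuous (horner p)} by exact: continuous_horner.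
exists W => j jN; have j1N : (j.+1 %% N.+1 < N.+1)%N by rewrite ltn_mod.
have ij : (inord j : 'I_N.+1) = j :> nat by rewrite inordK.
have ij1 : (inord (j.+1 %% N.+1) : 'I_N.+1) = (j.+1 %% N.+1)%N :> nat by rewrite inordK.
have tl : trace_left a b N.+1 j w = (W j).[1].
  rewrite WE mulr1 -ndS /trace_left -/(nd _); apply: (@lim_left_eq _ _ _ (nd j)) => //.
  by have := qw (inord j); rewrite ij.
have dtl : trace_left a b N.+1 j (derive1 w) = (W j)^`().[1] / h.
  rewrite dWE mulr1 mulrC mulKf // -ndS /trace_left -/(nd _).
  apply: (@lim_left_eq _ _ _ (nd j)) => //.
  by have := dqw (inord j); rewrite ij.
have tr : trace_right a b N.+1 j w = (W (j.+1 %% N.+1)%N).[0].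
  rewrite WE mulr0 addr0 /trace_right -/(nd _).
  apply: (@lim_right_eq _ _ _ _ (nd (j.+1 %% N.+1).+1)) => //.
  by have := qw (inord (j.+1 %% N.+1)); rewrite ij1.
have dtr : trace_right a b N.+1 j (derive1 w) = (W (j.+1 %% N.+1)%N)^`().[0] / h.
  rewrite dWE mulr0 addr0 mulrC mulKf // /trace_right -/(nd _).
  apply: (@lim_right_eq _ _ _ _ (nd (j.+1 %% N.+1).+1)) => //.
  by have := dqw (inord (j.+1 %% N.+1)); rewrite ij1.
have [mom jmp djmp] := wP (inord j).
rewrite /average /jump ij tl tr dtl dtr -/(nd _) in mom jmp djmp.
split => //.
- by apply: size_affine_le; exact: (qP (inord j)).1.
- move=> x xj; rewrite WE mulrC divfK // addrC subrK; apply: qw; rewrite ij //.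
(* The projection is tested on the physical cell, so p is pulled back by x -> (x - nd j) / h, which
   does not raise its degree. *)
- move=> p sp; pose G x := ((q (inord j)).[x] - u x) * (p \Po (h^-1 *: 'X + (- nd j / h)%:P)).[x].
  have Gc : continuous G.
    apply: continuous_mul; last exact: continuous_horner.
    by move=> x; apply: cvgB; [exact: continuous_horner | exact: uc].
  have E t : G (nd j + h * t) = ((W j).[t] - u (nd j + h * t)) * p.[t].
    rewrite /G WE horner_affine; congr (_ * p.[_]); by field.
  have := Rintegral_affine (nd j) h0 Gc.
  under [X in h * X]eq_Rintegral do rewrite E.
  set I := (X in h * X); move=> hI; apply/eqP; suff : h * I == 0 by rewrite mulf_eq0 (negbTE hN).
  rewrite -hI -ndS; have sp' : (size (p \Po (h^-1 *: 'X + (- nd j / h)%:P)) <= m)%N.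
    exact: size_affine_le.
  pose P x := (p \Po (h^-1 *: 'X + (- nd j / h)%:P)).[x].
  have c1 : continuous (fun x => (q (inord j)).[x] * P x).
    by apply: continuous_mul; exact: continuous_horner.
  have c2 : continuous (fun x => u x * P x).
    by apply: continuous_mul => //; exact: continuous_horner.
  have wq : \int[@lebesgue_measure R]_(x in cell a b N.+1 j) (w x * P x) =
      \int[@lebesgue_measure R]_(x in `]nd j, nd j.+1[) ((q (inord j)).[x] * P x).
    apply: eq_Rintegral => x; rewrite inE /cell /= in_itv /= => xj; congr (_ * _).
    by apply: qw; rewrite ij.
  have qu : \int[@lebesgue_measure R]_(x in `]nd j, nd j.+1[) ((q (inord j)).[x] * P x) =
      \int[@lebesgue_measure R]_(x in `]nd j, nd j.+1[) (u x * P x).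
    exact: etrans (esym wq) (mom _ sp').
  rewrite !Rintegral_oo_cc // in qu.
  have -> : \int[@lebesgue_measure R]_(x in `[nd j, nd j.+1]) G x =
      \int[@lebesgue_measure R]_(x in `[nd j, nd j.+1]) ((q (inord j)).[x] * P x - u x * P x).
    by apply: eq_Rintegral => x _; rewrite /G mulrBl.
  rewrite leb_RintegralB; [|exact: leb_measurable_itv|exact: continuous_integrable_itv..].
  by rewrite subr_eq0; apply/eqP.
- by rewrite djmp (is_derive_derive1 ud).
Qed.

(* The coordinates ca, cb of the trace (e1, e1') and da, db of (f0, f0') are
   chosen so that a polynomial with vanishing moments has equal coordinates at
   both ends of its cell. *)
Lemma cell_transfer (R : realType) (k : nat) (h alpha1 beta1 beta2 e1 e1' f0 f0' : R) :
  (0 < k)%N -> h != 0 ->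
  (f0 + e1) / 2 - alpha1 * (f0 - e1) + beta2 * (f0' / h - e1' / h) = 0 ->
  (f0' / h + e1' / h) / 2 + alpha1 * (f0' / h - e1' / h) + beta1 * (f0 - e1) = 0 ->
  let K := k%:R in
  let s := (-1) ^+ k in
  let ca := (K * (K + 1) * e1 - e1') / (2 * K) in
  let cb := (e1' - K * (K - 1) * e1) / (2 * K) in
  let db := - s * (f0' / K + (K - 1) * f0) / 2 in
  let da := db - s * f0 in
  let G := Gamma_ k h alpha1 beta1 beta2 in
  let L := Lambda_ k h alpha1 beta1 beta2 in
  let c2 := c2_ k h alpha1 in
  let b1 := b1_ k h alpha1 beta1 beta2 in
  let b2 := b2_ k h alpha1 beta1 beta2 in
  L * ca = (-1) ^+ k.+1 * (G * da + c2 * da + (b1 + b2) * db) /\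
  L * cb = (-1) ^+ k.+1 * (G * db + (b1 - b2) * da - c2 * db).
Proof.
move=> k0 h0 E1 E2 K s ca cb db da G L c2 b1 b2.
have K0 : K != 0 by rewrite pnatr_eq0 -lt0n.
(* The determinant of the interface conditions as a linear system in (e1, e1' / h); times 2k / h it
   is [Lambda_]. The next two identities are Cramer's rule. *)
pose D := 1 / 4 - alpha1 ^+ 2 - beta1 * beta2.
have De1 : D * e1 = - (((1 / 2 - alpha1) ^+ 2 + beta1 * beta2) * f0 + beta2 * (f0' / h)).
  apply/eqP; rewrite -subr_eq0; apply/eqP.
  rewrite -[RHS](_ : (1 / 2 - alpha1) * ((f0 + e1) / 2 - alpha1 * (f0 - e1) + beta2 * (f0' / h - e1' / h))
    + beta2 * ((f0' / h + e1' / h) / 2 + alpha1 * (f0' / h - e1' / h) + beta1 * (f0 - e1)) = 0).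
    by rewrite /D; field.
  by rewrite E1 E2 !mulr0 addr0.
have De1' : D * e1' = - (h * beta1 * f0 + ((1 / 2 + alpha1) ^+ 2 + beta1 * beta2) * f0').
  apply/eqP; rewrite -subr_eq0; apply/eqP.
  rewrite -[RHS](_ : h * (beta1 * ((f0 + e1) / 2 - alpha1 * (f0 - e1) + beta2 * (f0' / h - e1' / h))
    + (1 / 2 + alpha1) * ((f0' / h + e1' / h) / 2 + alpha1 * (f0' / h - e1' / h) + beta1 * (f0 - e1))) = 0).
    by rewrite /D; field.
  by rewrite E1 E2 !mulr0 addr0 mulr0.
have LE : L = 2 * K / h * D by rewrite /L /Lambda_ /D -/K; field.
have -> : L * ca = (K * (K + 1) * (D * e1) - D * e1') / h by rewrite LE /ca; field; rewrite h0.
have -> : L * cb = (D * e1' - K * (K - 1) * (D * e1)) / h by rewrite LE /cb; field; rewrite h0.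
rewrite De1 De1' /da /db /G /c2 /b1 /b2 /Gamma_ /c2_ /b1_ /b2_ -/K (exprS (-1) k) -/s.
have [->|->] : s = 1 \/ s = -1.
  by rewrite /s -signr_odd; case: (odd k); [right|left].
- by split; field; rewrite h0 K0.
- by split; field; rewrite h0 K0.
Qed.

(** The endpoint relations in the coordinates of [cell_transfer]: the coordinates at the two ends of
    a cell agree up to the defects r1, r2. *)
Lemma cell_defect (R : realType) (K s e0 e0' e1 e1' r1 r2 : R) : K != 0 -> s * s = 1 ->
  K * e1 + s * (e0' + K ^+ 2 * e0) = r1 ->
  e1' - K ^+ 2 * e1 - s * K * e0 = r2 ->
  (K * (K + 1) * e1 - e1') / (2 * K) - (- s * (e0' / K + (K - 1) * e0) / 2 - s * e0) =
    (r1 - r2) / (2 * K) /\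
  (e1' - K * (K - 1) * e1) / (2 * K) - (- s * (e0' / K + (K - 1) * e0) / 2) =
    (r1 + r2) / (2 * K).
Proof. by move=> K0 ss <- <-; split; field. Qed.

(** * Spectral structure and the periodic recursion *)

(** The trace-free matrix A with rows (c2, b1 + b2) and (b1 - b2, -c2) satisfies A^2 = c2^2 + b1^2 -
    b2^2. The identity thus gives A the eigenvalues s and -s, with s = [sqrt_disc], and makes (A +
    s) / (2s) = [Q1_] a projector. *)
Lemma discriminant_identity (R : realType) (k : nat) (h alpha1 beta1 beta2 : R) : h != 0 ->
  c2_ k h alpha1 ^+ 2 + b1_ k h alpha1 beta1 beta2 ^+ 2 - b2_ k h alpha1 beta1 beta2 ^+ 2 =
  Gamma_ k h alpha1 beta1 beta2 ^+ 2 - Lambda_ k h alpha1 beta1 beta2 ^+ 2.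
Proof. by move=> h0; rewrite /c2_ /b1_ /b2_ /Gamma_ /Lambda_; field. Qed.

Lemma cmodM (R : realType) (x y : R[i]) : cmod (x * y) = cmod x * cmod y.
Proof. exact: ComplexField.Normc.normcM. Qed.

Lemma cmodD (R : realType) (x y : R[i]) : cmod (x + y) <= cmod x + cmod y.
Proof. exact: le_normcD. Qed.

Lemma cmodN (R : realType) (x : R[i]) : cmod (- x) = cmod x.
Proof. exact: normcN. Qed.

Lemma cmod_ge0 (R : realType) (x : R[i]) : 0 <= cmod x.
Proof. by case: x => x y; exact: sqrtr_ge0. Qed.

Lemma cmod0 (R : realType) : cmod (0 : R[i]) = 0.
Proof. exact: ComplexField.Normc.normc0. Qed.

Lemma cmod1 (R : realType) : cmod (1 : R[i]) = 1.
Proof. exact: ComplexField.Normc.normc1. Qed.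

Lemma cmodX (R : realType) (x : R[i]) (n : nat) : cmod (x ^+ n) = cmod x ^+ n.
Proof.
elim: n => [|n IH]; first exact: cmod1.
by rewrite !exprS cmodM IH.
Qed.

Lemma cmodV (R : realType) (x : R[i]) : cmod x^-1 = (cmod x)^-1.
Proof. exact: ComplexField.Normc.normcV. Qed.

Lemma cmod_real (R : realType) (x : R) : cmod x%:C%C = `|x|.
Proof. by rewrite /cmod /= expr0n addr0 sqrtr_sqr. Qed.

Lemma Re_le_cmod (R : realType) (x : R[i]) : `|complex.Re x| <= cmod x.
Proof.
case: x => x y /=; rewrite -sqrtr_sqr; apply: ler_wsqrtr.
by rewrite lerDl sqr_ge0.
Qed.

Lemma cmod_sum (R : realType) (I : Type) (r : seq I) (F : I -> R[i]) :
  cmod (\sum_(i <- r) F i) <= \sum_(i <- r) cmod (F i).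
Proof.
elim/big_rec2: _ => [|i y x _ xy]; first by rewrite cmod0.
by rewrite (le_trans (cmodD _ _)) // lerD2l.
Qed.

Lemma lambda1_cmod (R : realType) (k : nat) (h alpha1 beta1 beta2 : R) :
  `|Gamma_ k h alpha1 beta1 beta2| < `|Lambda_ k h alpha1 beta1 beta2| ->
  cmod (lambda1 k h alpha1 beta1 beta2) = 1.
Proof.
rewrite /lambda1 /sqrt_disc; set G := Gamma_ _ _ _ _ _; set L := Lambda_ _ _ _ _ _ => GL.
have L0 : L != 0 by rewrite -normr_gt0 (le_lt_trans _ GL).
have GL2 : 0 <= L ^+ 2 - G ^+ 2.
  by rewrite subr_ge0 -(real_normK (num_real G)) -(real_normK (num_real L)) ler_sqr ?nnegrE // ltW.
rewrite !cmodM cmodX cmodN cmodV cmod_real cmod1 expr1n mul1r.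
have -> : cmod (G%:C%C + (0 +i* Num.sqrt (L ^+ 2 - G ^+ 2))%C) = `|L|.
  rewrite /cmod /= addr0 add0r sqr_sqrtr // addrC subrK; exact: sqrtr_sqr.
by rewrite mulVf // normr_eq0.
Qed.

Lemma sqrt_disc_neq0 (R : realType) (k : nat) (h alpha1 beta1 beta2 : R) :
  `|Gamma_ k h alpha1 beta1 beta2| < `|Lambda_ k h alpha1 beta1 beta2| ->
  sqrt_disc k h alpha1 beta1 beta2 != 0.
Proof.
rewrite /sqrt_disc; set G := Gamma_ _ _ _ _ _; set L := Lambda_ _ _ _ _ _ => GL.
rewrite eq_complex /= negb_and eqxx /= sqrtr_eq0 -ltNge subr_gt0.
by rewrite -(real_normK (num_real G)) -(real_normK (num_real L)) ltr_sqr ?nnegrE.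
Qed.

Lemma sqrt_disc_sqr (R : realType) (k : nat) (h alpha1 beta1 beta2 : R) : h != 0 ->
  `|Gamma_ k h alpha1 beta1 beta2| < `|Lambda_ k h alpha1 beta1 beta2| ->
  sqrt_disc k h alpha1 beta1 beta2 ^+ 2 =
  (c2_ k h alpha1 ^+ 2 + b1_ k h alpha1 beta1 beta2 ^+ 2 - b2_ k h alpha1 beta1 beta2 ^+ 2)%:C%C.
Proof.
move=> h0 GL; rewrite discriminant_identity //; move: GL; rewrite /sqrt_disc.
set G := Gamma_ _ _ _ _ _; set L := Lambda_ _ _ _ _ _ => GL.
apply/eqP; rewrite expr2 eq_complex /= !mul0r mulr0 addr0 eqxx andbT sub0r.
rewrite -expr2 sqr_sqrtr ?opprB // subr_ge0.
by rewrite -(real_normK (num_real G)) -(real_normK (num_real L)) ler_sqr ?nnegrE // ltW.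
Qed.

Lemma Q1_mulE (R : realType) (k : nat) (h alpha1 beta1 beta2 : R) (v : 'cV[R[i]]_2) (i : 'I_2) :
  let s := sqrt_disc k h alpha1 beta1 beta2 in
  let c2 := c2_ k h alpha1 in
  let b1 := b1_ k h alpha1 beta1 beta2 in
  let b2 := b2_ k h alpha1 beta1 beta2 in
  (Q1_ k h alpha1 beta1 beta2 *m v) i ord0 = (2 * s)^-1 *
  (if i == ord0 then (c2%:C%C + s) * v ord0 ord0 + (b1 + b2)%:C%C * v ord_max ord0
  else (b1 - b2)%:C%C * v ord0 ord0 + (- c2%:C%C + s) * v ord_max ord0).
Proof.
move=> s c2 b1 b2; rewrite mxE big_ord_recl big_ord1 !mxE -!mulrA -mulrDr; congr (_ * _).
have -> : lift ord0 ord0 = ord_max :> 'I_2 by apply: val_inj.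
rewrite -/s -/c2 -/b1 -/b2; clearbody s c2 b1 b2.
by rewrite rmorphB rmorphD; case: i => [[|[|//]] ?] /=.
Qed.

(* Multiplying by Q1, the spectral projector for lambda1, decouples the system. *)
Lemma Q1_eigen (R : realType) (k : nat) (h alpha1 beta1 beta2 : R) (c d : 'cV[R]_2) :
  let G := Gamma_ k h alpha1 beta1 beta2 in
  let L := Lambda_ k h alpha1 beta1 beta2 in
  let c2 := c2_ k h alpha1 in
  let b1 := b1_ k h alpha1 beta1 beta2 in
  let b2 := b2_ k h alpha1 beta1 beta2 in
  h != 0 -> `|G| < `|L| ->
  L * c ord0 ord0 = (-1) ^+ k.+1 *
    (G * d ord0 ord0 + c2 * d ord0 ord0 + (b1 + b2) * d ord_max ord0) ->
  L * c ord_max ord0 = (-1) ^+ k.+1 *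
    (G * d ord_max ord0 + (b1 - b2) * d ord0 ord0 - c2 * d ord_max ord0) ->
  Q1_ k h alpha1 beta1 beta2 *m complexify c =
  lambda1 k h alpha1 beta1 beta2 *: (Q1_ k h alpha1 beta1 beta2 *m complexify d).
Proof.
move=> G L c2 b1 b2 h0 GL E1 E2.
have L0 : L != 0 by rewrite -normr_gt0 (le_lt_trans _ GL).
have s0 := sqrt_disc_neq0 GL; have s2 := sqrt_disc_sqr h0 GL.
have c0E : c ord0 ord0 = L^-1 * (L * c ord0 ord0) by rewrite mulKf.
have c1E : c ord_max ord0 = L^-1 * (L * c ord_max ord0) by rewrite mulKf.
apply/colP => i; rewrite [RHS]mxE !Q1_mulE; move: s0 s2; rewrite /lambda1.
set s := sqrt_disc _ _ _ _ _ => s0 s2; rewrite mulrCA; congr (_ * _).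
have L0C : L%:C%C != 0 by rewrite -(rmorph0 (@real_complex R)) (inj_eq (@complexI R)).
rewrite !mxE c0E c1E E1 E2 -/G -/L -/c2 -/b1 -/b2.
have Ls2 : s ^+ 2 = c2%:C%C ^+ 2 + b1%:C%C ^+ 2 - b2%:C%C ^+ 2.
  by rewrite s2 -/c2 -/b1 -/b2 rmorphB rmorphD !rmorphXn.
have e : ((-1) ^+ k.+1 : R)%:C%C = (-1) ^+ k.+1 by rewrite rmorphXn rmorphN rmorph1.
move: (d ord0 ord0) (d ord_max ord0) => x y.
clear E1 E2 c0E c1E s2 GL; clearbody s c2 b1 b2 G L.
move: ((-1) ^+ k.+1 : R) ((-1) ^+ k.+1 : R[i]) e => eps epsC e.
rewrite !(rmorphM, rmorphD, rmorphN) fmorphV /= e; case: ifP => _; apply/eqP; rewrite -subr_eq0.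
(* In each row the two sides differ by a multiple of c2^2 + b1^2 - b2^2 - s^2, which is zero by
   [Ls2]. *)
- rewrite (_ : _ - _ = epsC / L%:C%C * x%:C%C *
    (c2%:C%C ^+ 2 + b1%:C%C ^+ 2 - b2%:C%C ^+ 2 - s ^+ 2)); last by field.
  by rewrite Ls2 subrr mulr0.
- rewrite (_ : _ - _ = epsC / L%:C%C * y%:C%C *
    (c2%:C%C ^+ 2 + b1%:C%C ^+ 2 - b2%:C%C ^+ 2 - s ^+ 2)); last by field.
  by rewrite Ls2 subrr mulr0.
Qed.

(* The complementary projector is the entrywise conjugate of Q1. *)
Lemma Q1_Re (R : realType) (k : nat) (h alpha1 beta1 beta2 : R) (c : 'cV[R]_2) (i : 'I_2) :
  `|Gamma_ k h alpha1 beta1 beta2| < `|Lambda_ k h alpha1 beta1 beta2| ->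
  c i ord0 = 2 * complex.Re ((Q1_ k h alpha1 beta1 beta2 *m complexify c) i ord0).
Proof.
move=> GL; have s0 := sqrt_disc_neq0 GL; rewrite Q1_mulE !mxE.
move: s0; rewrite /sqrt_disc; set t := Num.sqrt _ => s0.
move: (c2_ _ _ _) (b1_ _ _ _ _ _) (b2_ _ _ _ _ _) => p q r.
have t0 : t != 0 by move: s0; rewrite eq_complex /= negb_and eqxx.
case: i => [[|[|//]] ilt] /=.
- rewrite (_ : Ordinal ilt = ord0); last exact: val_inj.
  by field.
- rewrite (_ : Ordinal ilt = ord_max); last exact: val_inj.
  by field.
Qed.

Lemma Q1_Re_le (R : realType) (k : nat) (h alpha1 beta1 beta2 : R) (c : 'cV[R]_2) (i : 'I_2) :
  `|Gamma_ k h alpha1 beta1 beta2| < `|Lambda_ k h alpha1 beta1 beta2| ->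
  `|c i ord0| <= 2 * cmod ((Q1_ k h alpha1 beta1 beta2 *m complexify c) i ord0).
Proof.
by move=> GL; rewrite (Q1_Re c i GL) normrM ger0_norm // ler_wpM2l // Re_le_cmod.
Qed.

Lemma vnorm_oo_ge (R : realType) (n : nat) (v : 'cV[R[i]]_n) (i : 'I_n) :
  cmod (v i ord0) <= vnorm_oo v.
Proof. exact: (le_bigmax _ (fun i => cmod (v i ord0)) i). Qed.

Lemma vnorm_oo_le (R : realType) (n : nat) (v : 'cV[R[i]]_n) (B : R) : 0 <= B ->
  (forall i, cmod (v i ord0) <= B) -> vnorm_oo v <= B.
Proof. by move=> B0 vB; apply/bigmax_leP; split. Qed.

Lemma vnorm_oo_ge0 (R : realType) (n : nat) (v : 'cV[R[i]]_n) : 0 <= vnorm_oo v.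
Proof. by rewrite /vnorm_oo; elim/big_ind: _ => // [x y x0 y0|i _]; [rewrite le_max x0|exact: cmod_ge0]. Qed.

(** The supremum defining [mnorm_oo] has its usual properties only for a nonempty bounded set; the
    crude bound by the sum of all entries provides this. *)
Lemma mnorm_oo_ub (R : realType) (n : nat) (A : 'M[R[i]]_n) :
  has_sup [set vnorm_oo (A *m v) | v in [set v : 'cV[R[i]]_n | vnorm_oo v <= 1]].
Proof.
split.
  exists (vnorm_oo (A *m 0)); exists 0 => //=.
  by apply: vnorm_oo_le => // i; rewrite mxE cmod0.
exists (\sum_i \sum_j cmod (A i j)) => _ [v /= v1 <-].
apply: vnorm_oo_le => [|i].
  by apply: sumr_ge0 => i _; apply: sumr_ge0 => j _; exact: cmod_ge0.
rewrite (bigD1 i) //= -[leLHS]addr0 lerD //; last first.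
  by apply: sumr_ge0 => l _; apply: sumr_ge0 => j _; exact: cmod_ge0.
rewrite mxE (le_trans (cmod_sum _ _)) //; apply: ler_sum => j _.
rewrite cmodM -[leRHS]mulr1 ler_wpM2l ?cmod_ge0 //.
exact: le_trans (vnorm_oo_ge v j) v1.
Qed.

Lemma mnorm_oo_ge0 (R : realType) (n : nat) (A : 'M[R[i]]_n) : 0 <= mnorm_oo A.
Proof.
have [_ ub] := mnorm_oo_ub A; apply: (@le_trans _ _ (vnorm_oo (A *m 0))).
  exact: vnorm_oo_ge0.
apply: ub_le_sup => //; exists 0 => //=.
by apply: vnorm_oo_le => // i; rewrite mxE cmod0.
Qed.

Lemma mnorm_oo_mul (R : realType) (n : nat) (A : 'M[R[i]]_n) (v : 'cV[R[i]]_n) :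
  vnorm_oo (A *m v) <= mnorm_oo A * vnorm_oo v.
Proof.
have := vnorm_oo_ge0 v; rewrite le_eqVlt => /predU1P[v0|v0].
  rewrite -v0 mulr0; suff -> : v = 0.
    by rewrite mulmx0; apply: vnorm_oo_le => // i; rewrite mxE cmod0.
  apply/colP => i; rewrite mxE; apply: ComplexField.Normc.eq0_normc; apply/eqP.
  by rewrite eq_le cmod_ge0 andbT (le_trans (vnorm_oo_ge v i)) // -v0.
have cr (x : R) : 0 <= x -> cmod x%:C%C = x by move=> x0; rewrite cmod_real ger0_norm.
pose r := vnorm_oo v; have [_ ub] := mnorm_oo_ub A.
have le1 : vnorm_oo (A *m (r^-1%:C%C *: v)) <= mnorm_oo A.
  apply: ub_le_sup => //; exists (r^-1%:C%C *: v) => //=.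
  apply: vnorm_oo_le => // i; rewrite mxE cmodM cr ?invr_ge0 ?(ltW v0) //.
  by rewrite ler_pdivrMl // mulr1 vnorm_oo_ge.
apply: vnorm_oo_le => [|i]; first by rewrite mulr_ge0 ?mnorm_oo_ge0 ?ltW.
rewrite -ler_pdivrMr //; apply: le_trans le1; apply: le_trans (vnorm_oo_ge _ i).
by rewrite -scalemxAr [X in _ <= cmod X]mxE cmodM cr ?invr_ge0 ?(ltW v0) // mulrC.
Qed.

Lemma abel_sum (R : comNzRingType) (x : R) (g : nat -> R) (n : nat) :
  (1 - x) * \sum_(l < n.+1) x ^+ l * g l =
  g 0%N - x ^+ n.+1 * g n + \sum_(l < n) x ^+ l.+1 * (g l.+1 - g l).
Proof.
elim: n => [|n IH]; first by rewrite big_ord_recr !big_ord0 /= expr0 expr1; ring.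
rewrite big_ord_recr mulrDr IH [in RHS]big_ord_recr /= !exprS; ring.
Qed.

(* Summation by parts: a smooth g costs one factor 1 - x, while n * D stays
   bounded because n h is the length of the interval. *)
Lemma abel_bound (R : realType) (x : R[i]) (g : nat -> R[i]) (n : nat) (B D : R) :
  cmod x = 1 -> (forall l, cmod (g l) <= B) -> (forall l, cmod (g l.+1 - g l) <= D) ->
  cmod (1 - x) * cmod (\sum_(l < n.+1) x ^+ l * g l) <= 2 * B + n%:R * D.
Proof.
move=> x1 gB gD; have xl l : cmod (x ^+ l) = 1 by rewrite cmodX x1 expr1n.
rewrite -cmodM abel_sum (le_trans (cmodD _ _)) // lerD //.
  rewrite (le_trans (cmodD _ _)) // cmodN cmodM xl mul1r mulr2n mulrDl mul1r.
  exact: lerD.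
rewrite (le_trans (cmod_sum _ _)) //.
rewrite (le_trans (ler_sum _ (_ : forall i : 'I_n, true -> _ <= D))) //.
  by move=> l _; rewrite cmodM xl mul1r.
by rewrite sumr_const card_ord mulr_natl.
Qed.

Lemma periodic_recursion (R : comNzRingType) (x : R) (z g : nat -> R) (n : nat) :
  (forall j, z j = x * (z j.+1 - g j.+1)) -> (forall j, z (j + n)%N = z j) ->
  forall j, (1 - x ^+ n) * z j = - x * \sum_(l < n) x ^+ l * g (j.+1 + l)%N.
Proof.
(* Periodicity enters once, turning the second z_j into z_(j+n); what remains is the unrolled
   recursion, valid for every n. *)
move=> zr zp j; rewrite mulrBl mul1r -{2}zp; elim: n {zp} => [|n IH].
  by rewrite big_ord0 expr0 mulr0 addn0 mul1r subrr.
rewrite big_ord_recr mulrDr -IH /= (zr (j + n)%N) !exprS addSn !addnS.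
ring.
Qed.

Lemma periodic_recursion_bound (R : realType) (x : R[i]) (z g : nat -> R[i]) (n : nat) (B D : R) :
  (0 < n)%N -> cmod x = 1 ->
  (forall j, z j = x * (z j.+1 - g j.+1)) -> (forall j, z (j + n)%N = z j) ->
  (forall l, cmod (g l) <= B) -> (forall l, cmod (g l.+1 - g l) <= D) ->
  forall j, cmod (1 - x) * cmod (1 - x ^+ n) * cmod (z j) <= 2 * B + n%:R * D.
Proof.
case: n => // n _ x1 zr zp gB gD j.
have D0 : 0 <= D by apply: le_trans (gD 0%N); exact: cmod_ge0.
rewrite -mulrA -cmodM (periodic_recursion zr zp) cmodM cmodN x1 mul1r.
apply: (@le_trans _ _ (2 * B + n%:R * D)).
  apply: (@abel_bound _ _ (fun l => g (j.+1 + l)%N)) => // l.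
  by rewrite addnS.
by rewrite lerD2l ler_wpM2r // ler_nat.
Qed.

(** * The error bound *)

Lemma periodic_derive (R : realType) (f df : R -> R) (L : R) :
  periodic L f -> (forall x : R, is_derive x 1 f (df x)) -> periodic L df.
Proof.
move=> fL fd x; have fE : (fun y => f (L + 1 * y)) = f.
  by apply/funext => y; rewrite mul1r addrC fL.
have d : is_derive x 1 f (df (L + 1 * x) * 1).
  by rewrite -fE; apply: is_derive_affine_comp; rewrite fE.
have := @derive_val _ _ _ _ _ _ _ d; rewrite (@derive_val _ _ _ _ _ _ _ (fd x)).
by rewrite mulr1 mul1r addrC => ->.
Qed.

Lemma nodeS (R : realType) (a b : R) (N j : nat) :
  node a b N j.+1 = node a b N j + meshsize a b N.
Proof. by rewrite /node -natr1 mulrDl mul1r addrA. Qed.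

Lemma nodeN (R : realType) (a b : R) (N : nat) : (0 < N)%N -> node a b N N = b.
Proof.
move=> N0; rewrite /node /meshsize mulrC divfK ?pnatr_eq0 -?lt0n //.
by rewrite addrC subrK.
Qed.

(** If the successor wraps around, it is node 0 instead of b, and the period b - a compensates.
    Neighbouring cells can then be compared without treating the last one separately. *)
Lemma periodic_node (R : realType) (a b : R) (N j : nat) (f : R -> R) (y : R) :
  (0 < N)%N -> periodic (b - a) f ->
  f (node a b N (j.+1 %% N) + y) = f (node a b N (j %% N) + meshsize a b N + y).
Proof.
move=> N0 fp; rewrite -nodeS modnS; case: ifP => // dvd.
have -> : (j %% N).+1 = N.
  apply/eqP; rewrite eqn_leq ltn_mod N0 /= leqNgt; apply/negP => lt.
  have := dvd; rewrite /dvdn -(addn1 j) -modnDml addn1 modn_small //.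
rewrite nodeN // /node mul0r addr0 -fp; congr f; ring.
Qed.

Lemma node_bound (R : realType) (a b : R) (N j : nat) : a < b -> (j < N)%N ->
  a <= node a b N j /\ node a b N j + meshsize a b N <= b.
Proof.
move=> ab jN; have N0 : (0 < N)%N by apply: leq_ltn_trans jN.
have h0 : 0 < meshsize a b N by rewrite divr_gt0 ?subr_gt0 // ltr0n.
split; first by rewrite lerDl mulr_ge0 // ltW.
rewrite -nodeS -{2}(nodeN a b N0) /node lerD2l ler_wpM2r ?(ltW h0) // ler_nat //.
Qed.

(** Two periods suffice: the segment from a point to its shift by one cell may cross b, but no more
    than that. *)
Lemma periodic_bound (R : realType) (a b M : R) (f : R -> R) : a < b ->
  periodic (b - a) f -> (forall x, a <= x <= b -> `|f x| <= M) ->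
  forall x, a <= x <= b + (b - a) -> `|f x| <= M.
Proof.
move=> ab fp fM x /andP[ax xb]; have [xb'|bx] := lerP x b; first by rewrite fM ?ax.
rewrite -[x](subrK (b - a)) fp fM //; apply/andP; split; lra.
Qed.

Lemma derivative_increment (R : realType) (f df : R -> R) (x h B : R) : 0 <= h ->
  (forall x : R, is_derive x 1 f (df x)) ->
  (forall y, x <= y <= x + h -> `|df y| <= B) -> `|f (x + h) - f x| <= h * B.
Proof.
move=> h0 fd dfB; have xh : x <= x + h by rewrite lerDl.
have [|c] := MVT_segment xh (fun y _ => fd y).
  by apply: continuous_subspaceT => y; exact: is_derive_continuous (fd y).
rewrite in_itv /= (addrC x) addrK => xc ->.
by rewrite normrM (ger0_norm h0) mulrC ler_wpM2l // dfB // addrC.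
Qed.

Lemma horner_theta_le1 (R : realType) (p q : nat) (t : R) : 0 <= t <= 1 ->
  `|('X^p * ('X + (-1)%:P) ^+ q).[t]| <= 1.
Proof.
move=> /andP[t0 t1]; rewrite hornerM hornerXn horner_exp hornerD hornerX hornerC.
rewrite normrM !normrX mulr_ile1 ?exprn_ge0 ?exprn_ile1 //; first by rewrite ger0_norm.
by rewrite ler_norml; apply/andP; split; lra.
Qed.

Lemma moment_defect_bound (R : realType) (m : nat) (s : R) (f : R -> R) (p : {poly R}) (B : R) :
  `|s| = 1 -> continuous f -> (forall t, 0 <= t <= 1 -> `|p.[t]| <= 1) ->
  (forall t, 0 <= t <= 1 -> `|f t| <= B) ->
  `|s / m`!%:R * \int[@lebesgue_measure R]_(t in `[0, 1]) (f t * p.[t])| <= B.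
Proof.
move=> s1 fc p1 fB; have B0 : 0 <= B by apply: le_trans (fB 0 _) => //; rewrite lexx ler01.
rewrite !normrM s1 mul1r normfV normr_nat.
apply: (@le_trans _ _ (1 * B)); last by rewrite mul1r.
apply: ler_pM => //.
  by rewrite invf_le1 ?ler1n ?ltr0n fact_gt0.
apply: Rintegral01_le; first by apply: continuous_mul => //; exact: continuous_horner.
move=> t t01; rewrite normrM -[B]mulr1; apply: ler_pM => //; [exact: fB | exact: p1].
Qed.

Lemma moment_defect_sub (R : realType) (c : R) (f g : R -> R) (p : {poly R}) :
  continuous f -> continuous g ->
  c * \int[@lebesgue_measure R]_(t in `[0, 1]) (f t * p.[t]) -
  c * \int[@lebesgue_measure R]_(t in `[0, 1]) (g t * p.[t]) =
  c * \int[@lebesgue_measure R]_(t in `[0, 1]) ((f t - g t) * p.[t]).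
Proof.
move=> fc gc; have cf : continuous (fun t => f t * p.[t]).
  by apply: continuous_mul => //; exact: continuous_horner.
have cg : continuous (fun t => g t * p.[t]).
  by apply: continuous_mul => //; exact: continuous_horner.
rewrite -mulrBr -leb_RintegralB; [|exact: leb_measurable_itv|exact: continuous_integrable_itv..].
by congr (_ * _); apply: eq_Rintegral => t _; rewrite mulrBl.
Qed.

Lemma complexifyB (R : realType) (n : nat) (u v : 'cV[R]_n) :
  complexify (u - v) = complexify u - complexify v.
Proof. by apply/colP => i; rewrite !mxE rmorphB. Qed.

Lemma vnorm_oo_complexify_col2 (R : realType) (x y B : R) :
  `|x| <= B -> `|y| <= B -> vnorm_oo (complexify (col2 x y)) <= B.
Proof.
move=> xB yB; apply: vnorm_oo_le => [|i]; first exact: le_trans xB.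
by rewrite !mxE cmod_real; case: i => [[|[|//]] ?].
Qed.

Lemma ord2P (i : 'I_2) : i = ord0 \/ i = ord_max.
Proof. by case: i => [[|[|//]] ?]; [left|right]; apply: val_inj. Qed.

(** As u has no jumps and equals its own average, subtracting it makes the interface conditions
    homogeneous. The factor h in [h * U'] turns u_x into a derivative in the reference
    coordinate. *)
Lemma transmission_error (R : realType)
    (alpha1 beta1 beta2 h X x X' x' U U' : R) : h != 0 ->
  (X + x) / 2 - alpha1 * (X - x) + beta2 * (X' / h - x' / h) = U ->
  (X' / h + x' / h) / 2 + alpha1 * (X' / h - x' / h) + beta1 * (X - x) = U' ->
  ((X - U) + (x - U)) / 2 - alpha1 * ((X - U) - (x - U))
    + beta2 * ((X' - h * U') / h - (x' - h * U') / h) = 0 /\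
  ((X' - h * U') / h + (x' - h * U') / h) / 2
    + alpha1 * ((X' - h * U') / h - (x' - h * U') / h) + beta1 * ((X - U) - (x - U)) = 0.
Proof.
move=> h0 E1 E2; split.
  by rewrite -[RHS](subrr U) -{5}E1; field.
by rewrite -[RHS](subrr U') -{5}E2; field.
Qed.

(** [F i] stands for the i-th derivative of u. The spectral gaps are kept exactly, as P; powers of h
    replace them only in the theorem. *)
Lemma Pstar_error_bound (R : realType) (m : nat) (a b : R) : a < b ->
  exists2 C : R, 0 < C &
  forall (N : nat) (alpha1 beta1 beta2 M : R) (F : nat -> R -> R) (w : R -> R),
    (0 < N)%N ->
    let h := meshsize a b N in
    let lam := lambda1 m.+1 h alpha1 beta1 beta2 in
    let P := cmod (1 - lam) * cmod (1 - lam ^+ N) in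
    `|Gamma_ m.+1 h alpha1 beta1 beta2| < `|Lambda_ m.+1 h alpha1 beta1 beta2| ->
    0 < P ->
    (forall i, (i < m.+3)%N -> forall x : R, is_derive x 1 (F i) (F i.+1 x)) ->
    periodic (b - a) (F 0%N) ->
    (forall i, (i <= m.+3)%N -> forall x, a <= x <= b -> `|F i x| <= M) ->
    is_Pstar a b N m.+1 alpha1 beta1 beta2 (F 0%N) w ->
    forall j x, (j < N)%N -> node a b N j < x < node a b N j.+1 ->
      `|w x - F 0%N x| <=
        C * (h ^+ m.+2 * M) * (1 + mnorm_oo (Q1_ m.+1 h alpha1 beta1 beta2) / P).
Proof.
move=> ab; have [Cc Cc0 cellB] := cell_bound R m.
pose K : R := m.+1%:R.
have K1 : 1 <= K by rewrite ler1n.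
have K0 : K != 0 by rewrite gt_eqF // (lt_le_trans ltr01).
(* 2 + (b - a) is the bound 2 + N h from summation by parts, 4 K^2 the cost of returning from the
   coordinates [c] to (e, e'), and [Cc] that of the passage from end data to the whole cell. *)
exists (Cc * (1 + 4 * K ^+ 2 * (2 + (b - a)))) => [|N alpha1 beta1 beta2 M F w N0].
  rewrite mulr_gt0 // ltr_wpDr // !mulr_ge0 ?sqr_ge0 //; lra.
move=> h lam P GL P0 Fd Fp0 FM /(Pstar_cells ab N0 (Fd 0%N isT))[W WP] j x jN xj.
have h0 : 0 < h by rewrite /h /meshsize divr_gt0 ?subr_gt0 // ltr0n.
have hn0 : h != 0 by rewrite gt_eqF.
have Nh : N%:R * h = b - a.
  by rewrite /h /meshsize mulrC divfK // pnatr_eq0 -lt0n.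
have hba : h <= b - a by rewrite -Nh ler_peMl ?(ltW h0) // ler1n.
have Fp i : (i <= m.+3)%N -> periodic (b - a) (F i).
  elim: i => [//|i IH] im; exact: periodic_derive (IH (ltnW im)) (Fd i im).
have M0 : 0 <= M by apply: le_trans (FM 0%N isT a _) => //; rewrite lexx ltW.
(* The factor h^i makes [v j i] the i-th derivative in t of u on cell j. Indices are reduced modulo
   N, so sequences over the cells are periodic on all naturals. *)
pose nd := node a b N; pose v (j i : nat) (t : R) : R := h ^+ i * F i (nd (j %% N)%N + h * t).
have jmN (l : nat) : (l %% N < N)%N by rewrite ltn_mod.
have vd l i : (i < m.+3)%N -> forall t : R, is_derive t 1 (v l i) (v l i.+1 t).
  move=> im t; have d : is_derive t 1 (fun t : R => F i (nd (l %% N)%N + h * t))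
      (F i.+1 (nd (l %% N)%N + h * t) * h).
    exact: is_derive_affine_comp (Fd i im _).
  have -> : v l i.+1 t = h ^+ i *: (F i.+1 (nd (l %% N)%N + h * t) * h).
    by rewrite /v /GRing.scale /= exprS; ring.
  exact: is_deriveZ.
have nd01 l t : 0 <= t <= 1 -> a <= nd (l %% N)%N + h * t <= b.
  move=> /andP[t0 t1]; have [n1 n2] := node_bound ab (jmN l); apply/andP; split.
    by rewrite (le_trans n1) // lerDl mulr_ge0 // ltW.
  by rewrite (le_trans _ n2) // lerD2l ler_piMr // ltW.
pose B0 := h ^+ m.+2 * M.
have B00 : 0 <= B0 by rewrite mulr_ge0 // exprn_ge0 // ltW.
have vB l t : 0 <= t <= 1 -> `|v l m.+2 t| <= B0.
  move=> t01; rewrite normrM normrX (gtr0_norm h0) ler_wpM2l ?exprn_ge0 ?(ltW h0) //.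
  by apply: FM; rewrite ?leqnSn ?nd01.
(* Here [F m.+3], the derivative of order k+2, is traded for a factor h. *)
have vD l t : 0 <= t <= 1 -> `|v l.+1 m.+2 t - v l m.+2 t| <= h * B0.
  move=> t01; rewrite /v (periodic_node _ _ N0 (Fp m.+2 (leqnSn _))) -mulrBr.
  rewrite normrM normrX (gtr0_norm h0) /B0 mulrCA ler_wpM2l ?exprn_ge0 ?(ltW h0) //.
  rewrite -addrA (addrC (meshsize _ _ _)) addrA.
  apply: (derivative_increment (ltW h0) (Fd m.+2 (ltnSn _))) => y /andP[y1 y2].
  apply: (periodic_bound ab (Fp m.+3 (leqnn _)) (FM m.+3 (leqnn _))).
  have /andP[n1 n2] := nd01 l t t01; apply/andP; split; first exact: le_trans n1 y1.
  by apply: le_trans y2 _; rewrite lerD.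
pose e (l i : nat) (t : R) : R := (W (l %% N)%N)^`(i).[t] - v l i t.
have ed l i : (i < m.+2)%N -> forall t : R, is_derive t 1 (e l i) (e l i.+1 t).
  move=> im t; have d1 := vd l i (ltnW im) t.
  have d2 := is_derive_poly (W (l %% N)%N)^`(i) t.
  by rewrite /e derivnS; exact: is_deriveB.
have vc l : continuous (v l m.+2).
  by move=> t; exact: is_derive_continuous (vd l m.+2 (ltnSn _) t).
have ec l : continuous (e l m.+2).
  by move=> t; apply: cvgB; [exact: continuous_horner|exact: vc].
have eE l t : e l m.+2 t = - v l m.+2 t.
  have [sW _ _ _ _] := WP _ (jmN l).
  by rewrite /e derivn_poly0 // horner0 sub0r.
have emom l (q : {poly R}) : (size q <= m)%N ->
    \int[@lebesgue_measure R]_(t in `[0, 1]) (e l 0%N t * q.[t]) = 0.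
  move=> sq; have [_ _ mom _ _] := WP _ (jmN l); rewrite -[RHS](mom q sq).
  by apply: eq_Rintegral => t _; rewrite /e /v derivn0 expr0 mul1r.
pose th1 : {poly R} := 'X^m * ('X + (-1)%:P) ^+ m.+1.
pose th2 : {poly R} := 'X^(m.+1) * ('X + (-1)%:P) ^+ m.
pose rho1 l := (-1) ^+ m.+1 / m`!%:R *
  \int[@lebesgue_measure R]_(t in `[0, 1]) (e l m.+2 t * th1.[t]).
pose rho2 l := (-1) ^+ m / m`!%:R *
  \int[@lebesgue_measure R]_(t in `[0, 1]) (e l m.+2 t * th2.[t]).
have sgn1 q : `|(-1) ^+ q : R| = 1 by rewrite normrX normrN1 expr1n.
have eB l t : 0 <= t <= 1 -> `|e l m.+2 t| <= B0 by move=> t01; rewrite eE normrN vB.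
have eD l t : 0 <= t <= 1 -> `|e l.+1 m.+2 t - e l m.+2 t| <= h * B0.
  by move=> t01; rewrite !eE opprK addrC distrC vD.
have ecD l : continuous (fun t => e l.+1 m.+2 t - e l m.+2 t).
  by move=> t; apply: cvgB; exact: ec.
have rho1B l : `|rho1 l| <= B0.
  by apply: moment_defect_bound => // t t01; [exact: horner_theta_le1 | exact: eB].
have rho2B l : `|rho2 l| <= B0.
  by apply: moment_defect_bound => // t t01; [exact: horner_theta_le1 | exact: eB].
have rho1D l : `|rho1 l.+1 - rho1 l| <= h * B0.
  rewrite /rho1 moment_defect_sub //.
  by apply: moment_defect_bound => // t t01; [exact: horner_theta_le1 | exact: eD].
have rho2D l : `|rho2 l.+1 - rho2 l| <= h * B0.
  rewrite /rho2 moment_defect_sub //.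
  by apply: moment_defect_bound => // t t01; [exact: horner_theta_le1 | exact: eD].
have halfB (r1 r2 B : R) : `|r1| <= B -> `|r2| <= B -> `|(r1 + r2) / (2 * K)| <= B.
  move=> r1B r2B; have B_ge0 : 0 <= B by apply: le_trans r1B.
  rewrite normrM normfV (gtr0_norm (_ : 0 < 2 * K)); last lra.
  rewrite ler_pdivrMr; last lra.
  rewrite (le_trans (ler_normD _ _)) //; apply: le_trans (lerD r1B r2B) _.
  by rewrite mulrA mulr2n mulrDr mulr1 ler_peMr // addr_ge0.
(* The defects in the coordinates of [cell_transfer]; [Q1_] times [y l] is the forcing g_l of the
   scalar recursion. *)
pose y l := col2 ((rho1 l - rho2 l) / (2 * K)) ((rho1 l + rho2 l) / (2 * K)).
have yB l : vnorm_oo (complexify (y l)) <= B0.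
  by apply: vnorm_oo_complexify_col2; apply: halfB; rewrite ?normrN.
have yD l : vnorm_oo (complexify (y l.+1 - y l)) <= h * B0.
  have -> : y l.+1 - y l = col2
      ((rho1 l.+1 - rho1 l + - (rho2 l.+1 - rho2 l)) / (2 * K))
      ((rho1 l.+1 - rho1 l + (rho2 l.+1 - rho2 l)) / (2 * K)).
    by apply/colP => i; rewrite !mxE; case: (ord2P i) => -> /=; field.
  by apply: vnorm_oo_complexify_col2; apply: halfB; rewrite ?normrN.
pose c l := col2 ((K * (K + 1) * e l 0%N 1 - e l 1%N 1) / (2 * K))
                 ((e l 1%N 1 - K * (K - 1) * e l 0%N 1) / (2 * K)).
(* [c l] belongs to the right end of cell l and [c l.+1 - y l.+1] to the left end of the next cell;
   the interface conditions between them yield the factor lambda1. *)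
have trans l : Q1_ m.+1 h alpha1 beta1 beta2 *m complexify (c l) = lam *:
    (Q1_ m.+1 h alpha1 beta1 beta2 *m complexify (c l.+1 - y l.+1)).
  have [sW _ _ jmp djmp] := WP _ (jmN l).
  have ll : ((l %% N).+1 %% N = l.+1 %% N)%N by rewrite -addn1 modnDml addn1.
  rewrite -/h ll nodeS -/h -/nd in jmp djmp.
  have E0 : e l.+1 0%N 0 = (W (l.+1 %% N)%N).[0] - F 0%N (nd (l %% N)%N + h).
    by rewrite /e /v derivn0 expr0 mul1r mulr0 periodic_node // addr0.
  have E0' : e l.+1 1%N 0 = (W (l.+1 %% N)%N)^`().[0] - h * F 1%N (nd (l %% N)%N + h).
    by rewrite /e /v derivn1 expr1 mulr0 (periodic_node _ _ N0 (Fp 1%N isT)) addr0.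
  have E1 : e l 0%N 1 = (W (l %% N)%N).[1] - F 0%N (nd (l %% N)%N + h).
    by rewrite /e /v derivn0 expr0 mul1r mulr1.
  have E1' : e l 1%N 1 = (W (l %% N)%N)^`().[1] - h * F 1%N (nd (l %% N)%N + h).
    by rewrite /e /v derivn1 expr1 mulr1.
  have t1 : (e l.+1 0%N 0 + e l 0%N 1) / 2 - alpha1 * (e l.+1 0%N 0 - e l 0%N 1)
      + beta2 * (e l.+1 1%N 0 / h - e l 1%N 1 / h) = 0.
    by rewrite E0 E0' E1 E1'; exact: (transmission_error hn0 jmp djmp).1.
  have t2 : (e l.+1 1%N 0 / h + e l 1%N 1 / h) / 2
      + alpha1 * (e l.+1 1%N 0 / h - e l 1%N 1 / h) + beta1 * (e l.+1 0%N 0 - e l 0%N 1) = 0.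
    by rewrite E0 E0' E1 E1'; exact: (transmission_error hn0 jmp djmp).2.
  have [T1 T2] := cell_transfer (ltn0Sn m) hn0 t1 t2.
  have ss : (-1) ^+ m.+1 * (-1) ^+ m.+1 = 1 :> R.
    by rewrite -exprD addnn -signr_odd odd_double.
  have [D1 D2] := cell_defect K0 ss
    (endpoint_relation1 (ed l.+1) (ec l.+1) (emom l.+1))
    (endpoint_relation2 (ed l.+1) (ec l.+1) (emom l.+1)).
  have d0 : (c l.+1 - y l.+1) ord0 ord0 =
      - (-1) ^+ m.+1 * (e l.+1 1%N 0 / K + (K - 1) * e l.+1 0%N 0) / 2
      - (-1) ^+ m.+1 * e l.+1 0%N 0.
    by rewrite !mxE /= -D1 subKr.
  have d1 : (c l.+1 - y l.+1) ord_max ord0 =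
      - (-1) ^+ m.+1 * (e l.+1 1%N 0 / K + (K - 1) * e l.+1 0%N 0) / 2.
    by rewrite !mxE /= -D2 subKr.
  apply: Q1_eigen => //; rewrite d0 d1 mxE /=; [exact: T1 | exact: T2].
pose Q1 := Q1_ m.+1 h alpha1 beta1 beta2; pose q := mnorm_oo Q1.
have q0 : 0 <= q by exact: mnorm_oo_ge0.
pose Z := q * B0 * (2 + (b - a)) / P.
have ba0 : 0 <= 2 + (b - a) by lra.
have Z0 : 0 <= Z by rewrite divr_ge0 ?(ltW P0) //; apply: mulr_ge0 => //; exact: mulr_ge0.
have zB l i : cmod ((Q1 *m complexify (c l)) i ord0) <= Z.
  rewrite ler_pdivlMr // mulrC.
  have -> : q * B0 * (2 + (b - a)) = 2 * (q * B0) + N%:R * (q * (h * B0)).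
    by rewrite -Nh; ring.
  apply: (@periodic_recursion_bound _ lam (fun l => (Q1 *m complexify (c l)) i ord0)
    (fun l => (Q1 *m complexify (y l)) i ord0)) => //.
  - exact: lambda1_cmod.
  - by move=> n; rewrite trans complexifyB mulmxBr !mxE.
  - by move=> n; rewrite /c /e /v modnDr.
  - move=> n; rewrite (le_trans (vnorm_oo_ge _ i)) // (le_trans (mnorm_oo_mul _ _)) //.
    by rewrite ler_wpM2l.
  - move=> n; have -> : (Q1 *m complexify (y n.+1)) i ord0 - (Q1 *m complexify (y n)) i ord0 =
        (Q1 *m complexify (y n.+1 - y n)) i ord0.
      by rewrite complexifyB mulmxBr [RHS]mxE [X in _ = _ + X]mxE.
    rewrite (le_trans (vnorm_oo_ge _ i)) // (le_trans (mnorm_oo_mul _ _)) //.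
    by rewrite ler_wpM2l.
have cB l i : `|c l i ord0| <= 2 * Z.
  by rewrite (le_trans (Q1_Re_le _ i GL)) // ler_wpM2l.
have e1E l : e l 0%N 1 = c l ord0 ord0 + c l ord_max ord0.
  by rewrite !mxE /=; field.
(* The coefficients add up to 2 K^2, and each coordinate is at most 2Z: hence 4 K^2 Z in B. *)
have e1'E l : e l 1%N 1 = K * (K - 1) * c l ord0 ord0 + K * (K + 1) * c l ord_max ord0.
  by rewrite !mxE /=; field.
have KZ : 2 * Z <= 2 * K ^+ 2 * Z by rewrite ler_wpM2r // ler_peMr // exprn_ege1.
pose B := B0 + 4 * K ^+ 2 * Z.
have B0B : B0 <= B by rewrite lerDl; apply: mulr_ge0 => //; rewrite mulr_ge0 ?sqr_ge0.
have e1B : `|e j 0%N 1| <= B.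
  rewrite e1E (le_trans (ler_normD _ _)) // (le_trans (lerD (cB j _) (cB j _))) //.
  have -> : B = B0 + (2 * K ^+ 2 * Z + 2 * K ^+ 2 * Z) by rewrite /B; ring.
  by rewrite -[leLHS]add0r lerD // lerD.
have e1'B : `|e j 1%N 1| <= B.
  rewrite e1'E (le_trans (ler_normD _ _)) // !normrM (ger0_norm (_ : 0 <= K)); last lra.
  rewrite (ger0_norm (_ : 0 <= K - 1)); last lra.
  rewrite (ger0_norm (_ : 0 <= K + 1)); last lra.
  have le0 : K * (K - 1) * `|c j ord0 ord0| <= K * (K - 1) * (2 * Z).
    by rewrite ler_wpM2l ?cB // mulr_ge0 //; lra.
  have le1 : K * (K + 1) * `|c j ord_max ord0| <= K * (K + 1) * (2 * Z).
    by rewrite ler_wpM2l ?cB // mulr_ge0 //; lra.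
  apply: le_trans (lerD le0 le1) _.
  have -> : K * (K - 1) * (2 * Z) + K * (K + 1) * (2 * Z) = 4 * K ^+ 2 * Z by ring.
  by rewrite lerDr.
have jj : (j %% N)%N = j by rewrite modn_small.
have [sW wW mom _ _] := WP j jN.
have t01 : 0 <= (x - nd j) / h <= 1.
  move: xj; rewrite nodeS -/h -/nd => /andP[x1 x2].
  by rewrite divr_ge0 ?(ltW h0) ?subr_ge0 ?(ltW x1) //= ler_pdivrMr // mul1r; lra.
have vd' i : (i < m.+2)%N -> forall t : R, is_derive t 1 (v j i) (v j i.+1 t).
  by move=> im; apply: vd; exact: ltnW.
have vB' t : 0 <= t <= 1 -> `|v j m.+2 t| <= B by move=> ?; exact: le_trans (vB _ _ _) B0B.
have mom' (p : {poly R}) : (size p <= m)%N ->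
    \int[@lebesgue_measure R]_(t in `[0, 1]) (((W j).[t] - v j 0%N t) * p.[t]) = 0.
  by move=> sp; have := emom j p sp; rewrite /e jj derivn0.
have b1 : `|(W j).[1] - v j 0%N 1| <= B by move: e1B; rewrite /e jj derivn0.
have b2 : `|(W j)^`().[1] - v j 1%N 1| <= B by move: e1'B; rewrite /e jj derivn1.
have := cellB (W j) (v j) B sW vd' vB' mom' b1 b2 _ t01.
have -> : v j 0%N ((x - nd j) / h) = F 0%N x.
  by rewrite /v expr0 mul1r jj mulrC divfK // addrC subrK.
rewrite (wW x xj) => /le_trans; apply.
rewrite -/B0 -/Q1 -/q; pose D1 := 4 * K ^+ 2 * (2 + (b - a)); rewrite -/D1.
have -> : B = B0 * (1 + D1 * (q / P)) by rewrite /B /Z /D1; ring.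
have D10 : 0 <= D1 by rewrite mulr_ge0 // mulr_ge0 ?sqr_ge0.
have qP : 0 <= q / P by rewrite divr_ge0 // ltW.
clearbody D1 B0; move: (q / P) qP => D2 D20.
have -> : Cc * (1 + D1) * B0 * (1 + D2) = Cc * (B0 * ((1 + D1) * (1 + D2))) by ring.
apply: ler_wpM2l; first exact: ltW.
apply: ler_wpM2l => //.
have -> : (1 + D1) * (1 + D2) = 1 + D1 * D2 + (D1 + D2) by ring.
by rewrite lerDl addr_ge0.
Qed.

(** * From pointwise bounds inside the cells to the L^p estimate *)

Lemma node_cases (R : realType) (a b : R) (N n : nat) (x : R) :
  a <= x <= node a b N n ->
  (exists i, x = node a b N i) \/
  (exists2 j, (j < n)%N & node a b N j < x < node a b N j.+1).
Proof.
elim: n => [|n IH] /andP[ax xn].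
  left; exists 0%N; apply/eqP; rewrite eq_le xn /= /node mul0r addr0 //.
have [xn'|nx] := leP x (node a b N n).
  have [|[i xi]|[j jn xj]] := IH; first by rewrite ax xn'.
    by left; exists i.
  by right; exists j => //; rewrite ltnW.
move: xn; rewrite le_eqVlt => /predU1P[->|xn]; first by left; exists n.+1.
by right; exists n => //; rewrite nx xn.
Qed.

(** At the nodes w is arbitrary, so the pointwise error bound holds only off this countable set. *)
Lemma ae_not_node (R : realType) (a b : R) (N : nat) :
  {ae @lebesgue_measure R, forall x, ~ exists i, x = node a b N i}.
Proof.
have cA : countable (range (node a b N)).
  exact: (sub_countable (card_image_le _ _) (countableP _)).
exists (range (node a b N)); split.
- by apply: countable_measurable => // t; exact: measurable_set1.
- exact: countable_lebesgue_measure0.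
- by move=> x /= /contrapT[i ->]; exists i.
Qed.

Lemma measurable_fun_piecewise (R : realType) (a b : R) (N n : nat) (f : R -> R) :
  a < b -> (n <= N)%N ->
  (forall j, (j < n)%N -> exists2 g : R -> R, continuous g &
     forall x, node a b N j < x < node a b N j.+1 -> f x = g x) ->
  measurable_fun `[a, node a b N n] f.
Proof.
move=> ab; elim: n => [|n IH] nN fg.
  have -> : `[a, node a b N 0]%classic = [set a] by rewrite /node mul0r addr0 set_itv1.
  apply: (eq_measurable_fun (cst (f a))) => //.
  by move=> x; rewrite inE => ->.
have [an nb] := node_bound ab nN.
have lt : node a b N n < node a b N n.+1.
  rewrite nodeS ltrDl divr_gt0 ?subr_gt0 // ltr0n; exact: leq_ltn_trans nN.
have -> : `[a, node a b N n.+1]%classic =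
    `[a, node a b N n] `|` `]node a b N n, node a b N n.+1[ `|` [set node a b N n.+1].
  apply/seteqP; split => x /=; rewrite !in_itv /=.
    move=> /andP[ax xn]; have [xn'|nx] := leP x (node a b N n); first by left; left; rewrite ax.
    by move: xn; rewrite le_eqVlt => /predU1P[->|xn]; [right|left; right].
  move=> [[/andP[-> /= xn]|/andP[nx xn]]|->].
  - exact: le_trans xn (ltW lt).
  - by rewrite (le_trans an (ltW nx)) ltW.
  - by rewrite (le_trans an (ltW lt)) lexx.
apply/measurable_funU.
- by apply: measurableU; exact: measurable_itv.
- exact: measurable_set1.
split; last first.
  by apply: (eq_measurable_fun (cst (f (node a b N n.+1)))) => // x; rewrite inE => ->.
apply/measurable_funU; [exact: measurable_itv|exact: measurable_itv|split].
  by apply: IH => [|j jn]; [exact: ltnW | apply: fg; exact: ltnW].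
have [g gc gE] := fg n (ltnSn n).
apply: (eq_measurable_fun g).
  by move=> x; rewrite inE /= in_itv /= => /gE ->.
by apply: measurable_funTS; exact: continuous_measurable_fun.
Qed.

(** 1 + (b - a) dominates both 1, the factor for p = oo, and the square root of b - a, the factor
    for p = 2, so one constant covers both norms. *)
Lemma Lp_norm_le_itv (R : realType) (a b : R) (f : R -> R) (p : \bar R) (B : R) :
  a < b -> 0 <= B -> measurable_fun `[a, b] f ->
  {ae @lebesgue_measure R, forall x, `[a, b]%classic x -> `|f x| <= B} ->
  p = 2%:E \/ p = +oo%E ->
  (Lp_norm `[a, b] p f <= ((1 + (b - a)) * B)%:E)%E.
Proof.
move=> ab B0 mf fB [->|->]; last first.
  apply: (@le_trans _ _ B%:E); first exact/Lp_normoo_le.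
  rewrite lee_fin ler_peMl //; lra.
rewrite /Lp_norm unlock /Lnorm.
have I2 : (\int[@lebesgue_measure R]_x (`|((EFin \o f \_ `[a, b]) x)| `^ 2)
    <= (((1 + (b - a)) * B) ^+ 2)%:E)%E.
  have -> : (\int[@lebesgue_measure R]_x (`|((EFin \o f \_ `[a, b]) x)| `^ 2) =
      \int[@lebesgue_measure R]_(x in `[a, b]) ((f x) ^+ 2)%:E)%E.
    rewrite [RHS]integral_mkcond; apply: eq_integral => x _.
    rewrite /= !patchE; case: ifPn => _ /=.
      by rewrite -[2]/(2%:R) powR_mulrn // real_normK // num_real.
    by rewrite normr0 -[2]/(2%:R) powR_mulrn // expr0n.
  apply: (@le_trans _ _ (\int[@lebesgue_measure R]_(x in `[a, b]) (B ^+ 2)%:E)%E).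
    apply: ae_ge0_le_integral => //.
    - by move=> x _; rewrite lee_fin sqr_ge0.
    - by apply/measurable_EFinP; exact: measurable_funX.
    - by move=> x _; rewrite lee_fin sqr_ge0.
    - apply: ae_sub fB => x h xab; rewrite lee_fin -real_normK ?num_real //.
      by rewrite ler_sqr ?nnegrE // h.
  rewrite integral_cst //= lebesgue_measure_itv /= lte_fin ab -EFinB -EFinM lee_fin.
  rewrite exprMn mulrC ler_wpM2r ?sqr_ge0 // expr2; nra.
have I0 : (0 <= \int[@lebesgue_measure R]_x (`|((EFin \o f \_ `[a, b]) x)| `^ 2))%E.
  by apply: integral_ge0 => x _; exact: poweR_ge0.
have r0 : 0 <= (1 + (b - a)) * B by rewrite mulr_ge0 //; lra.
apply: (@le_trans _ _ ((((1 + (b - a)) * B) ^+ 2)%:E `^ 2^-1)%E).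
  apply: gt0_ler_poweR => //; first by rewrite in_itv /= I0 leey.
  by rewrite in_itv /= lee_fin sqr_ge0 leey.
by rewrite poweR_EFin -powR_mulrn // -powRrM mulfV // powRr1.
Qed.

Theorem lemma3p9 (R : realType) (k : nat) (a b : R)
    (delta' delta : R) (cl cu dl du : R) :
  (1 <= k)%N -> a < b ->
  0 <= delta / 2 -> delta / 2 <= 1 ->
  0 < cl -> 0 < cu -> 0 < dl -> 0 < du ->
  exists C : R, 0 < C /\
  forall (N : nat) (alpha1 beta1 beta2 : R), (0 < N)%N ->
    let h := meshsize a b N in
    let Gamma := Gamma_ k h alpha1 beta1 beta2 in
    let Lambda := Lambda_ k h alpha1 beta1 beta2 in
    let lambda := lambda1 k h alpha1 beta1 beta2 in
    let Q1 := Q1_ k h alpha1 beta1 beta2 in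
    let V1 := complexify (V1_ k h alpha1 beta1 beta2) in
    let V2 := complexify (V2_ k h) in
    alpha1 ^+ 2 + beta1 * beta2 != 1 / 4 ->
    `|Gamma| < `|Lambda| ->
    lambda ^+ N != 1 ->
    exact_order cl cu (cmod (1 - lambda ^+ N)) h delta' ->
    exact_order dl du (cmod (lambda - 1)) h (delta / 2) ->
    forall (u w : R -> R) (p : \bar R),
      periodic (b - a) u -> continuous u -> in_Winfty k.+3 u ->
      is_Pstar a b N k alpha1 beta1 beta2 u w ->
      p = 2%:E \/ p = +oo%E ->
      (Lp_norm `[a, b] p (fun x => w x - u x)%R
       <= (C * h ^+ k.+1)%:E * Winfty_norm `[a, b] k.+3 u
          * (1 + h `^ (- (delta' + delta / 2)) * mnorm_oo Q1
                 * (vnorm_oo V1 + h^-1 * vnorm_oo V2))%:E)%E.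
Proof.
case: k => // m _ ab _ _ cl0 _ dl0 _.
have [C0 C00 key] := @Pstar_error_bound R m a b ab.
pose K : R := m.+1%:R.
have K0 : 0 < K by rewrite ltr0n.
(* 1 / (cl dl) comes from replacing 1 / P by a power of h, and 2K from the lower bound 1 / (2K) on
   the factor with [V1] and [V2]. *)
pose C1 := C0 * (1 + 2 * K / (cl * dl)).
have ba0 : 0 < b - a by rewrite subr_gt0.
have D0 : 0 < 2 * K / (cl * dl) by rewrite divr_gt0 ?mulr_gt0.
have C10 : 0 < C1 by rewrite mulr_gt0 // addr_gt0.
exists ((1 + (b - a)) * C1); split; first by rewrite mulr_gt0 // addr_gt0.
move=> N alpha1 beta1 beta2 N0 h Gamma Lambda lambda Q1 V1 V2 _ GL _ [eN _] [e1 _].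
move=> u w p up uc uW wP pE.
have h0 : 0 < h by rewrite divr_gt0 // ltr0n.
set s := h `^ (- _).
have s0 : 0 < s by exact: powR_gt0.
pose q := mnorm_oo Q1.
have q0 : 0 <= q by exact: mnorm_oo_ge0.
set r := vnorm_oo V1 + _.
have r0 : (2 * K)^-1 <= r.
  have V2ge : h / (2 * K) <= vnorm_oo V2.
    apply: le_trans (vnorm_oo_ge _ ord_max).
    have -> : V2 ord_max ord0 = (h / (2 * K))%:C%C by rewrite !mxE.
    by rewrite cmod_real; exact: ler_norm.
  apply: (@le_trans _ _ (h^-1 * vnorm_oo V2)); last by rewrite lerDr vnorm_oo_ge0.
  by rewrite [leRHS]mulrC ler_pdivlMr // mulrC.
pose P := cmod (1 - lambda) * cmod (1 - lambda ^+ N).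
have PE : cl * dl * s^-1 <= P.
  have sE : s^-1 = h `^ delta' * h `^ (delta / 2).
    by rewrite /s -powRN opprK powRD // (gt_eqF h0) implybT.
  have e1' : dl * h `^ (delta / 2) <= cmod (1 - lambda).
    by rewrite -opprB cmodN.
  rewrite sE mulrACA mulrC.
  by apply: ler_pM; rewrite // mulr_ge0 ?powR_ge0 // ltW.
have P0 : 0 < P.
  by apply: lt_le_trans PE; rewrite !mulr_gt0 // invr_gt0.
have qP : 1 + q / P <= (1 + 2 * K / (cl * dl)) * (1 + s * q * r).
  have Pi : P^-1 <= s / (cl * dl).
    rewrite -[leLHS]mul1r ler_pdivrMr // mulrAC ler_pdivlMr ?(mulr_gt0 cl0) // mul1r mulrC.
    by rewrite mulrC [leRHS]mulrC -ler_pdivrMr.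
  have h1 : q / P <= q * (s / (cl * dl)) by exact: ler_wpM2l.
  have h2 : q * (s / (cl * dl)) <= 2 * K / (cl * dl) * (s * q * r).
    have -> : q * (s / (cl * dl)) = 2 * K / (cl * dl) * (s * q * (2 * K)^-1).
      by field; rewrite !lt0r_neq0.
    apply: ler_wpM2l; first exact: ltW.
    by apply: ler_wpM2l => //; rewrite mulr_ge0 // ltW.
  have h3 : 0 <= s * q * r.
    by rewrite !mulr_ge0 ?(ltW s0) // (le_trans _ r0) // invr_ge0 mulr_ge0 ?ltW.
  nra.
have T0 : 0 < 1 + s * q * r.
  rewrite ltr_pwDl // !mulr_ge0 ?(ltW s0) // (le_trans _ r0) // invr_ge0 mulr_ge0 ?ltW //.
have CH0 : 0 < (1 + (b - a)) * C1 * h ^+ m.+2.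
  by rewrite mulr_gt0 ?exprn_gt0 // mulr_gt0 // addr_gt0.
have W0 : (0 <= Winfty_norm `[a, b] m.+4 u)%E.
  rewrite /Winfty_norm; elim/big_ind: _ => // [x y x0 y0|i _].
    by rewrite le_max x0.
  exact: Lnorm_ge0.
(* An infinite norm makes the right-hand side [+oo], since its other factors are positive; the value
   [-oo] contradicts [W0]. *)
case WE: (Winfty_norm `[a, b] m.+4 u) => [M| |]; last by rewrite WE in W0.
- have M0 : 0 <= M by rewrite WE lee_fin in W0.
  have Fb i : (i <= m.+3)%N -> forall x, a <= x <= b -> `|derive1n i u x| <= M.
    move=> im x axb; apply: (@Winfty_norm_bound R m.+3 u a b) => //.
    by rewrite WE.
  have Fd i : (i < m.+3)%N -> forall x : R, is_derive x 1 (derive1n i u) (derive1n i.+1 u x).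
    by move=> im; have [_ _] := Winfty_classical uc uW im; apply.
  have bnd := key N alpha1 beta1 beta2 M (fun i => derive1n i u) w N0 GL P0 Fd up Fb wP.
  have CM0 : 0 <= C0 * (h ^+ m.+2 * M).
    exact: mulr_ge0 (ltW C00) (mulr_ge0 (exprn_ge0 _ (ltW h0)) M0).
  set A := C0 * (h ^+ m.+2 * M) * (1 + q / P).
  have A0 : 0 <= A.
    rewrite mulr_ge0 ?CM0 // addr_ge0 // divr_ge0 //; exact: ltW.
  have mf : measurable_fun `[a, b] (fun x => w x - u x).
    rewrite -(nodeN a b N0); apply: measurable_fun_piecewise => // j jN.
    have [qq [_ wE]] := wP.1 (Ordinal jN).
    exists (fun x => qq.[x] - u x).
      by move=> x; apply: cvgB; [exact: continuous_horner|exact: uc].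
    by move=> x jx; rewrite wE // /cell /= in_itv.
  have ae : {ae @lebesgue_measure R, forall x, `[a, b]%classic x -> `|w x - u x| <= A}.
    apply: ae_sub (ae_not_node a b N) => x nx; rewrite /= in_itv /= -(nodeN a b N0).
    by move=> /node_cases[//|[j jN jx]]; exact: bnd jx.
  apply: (le_trans (Lp_norm_le_itv ab A0 mf ae pE)).
  rewrite -!EFinM lee_fin.
  have -> : (1 + (b - a)) * C1 * h ^+ m.+2 * M * (1 + s * q * r) =
    (1 + (b - a)) * (C0 * (h ^+ m.+2 * M) * ((1 + 2 * K / (cl * dl)) * (1 + s * q * r))).
    by rewrite /C1; ring.
  apply: ler_wpM2l; first by rewrite addr_ge0 // ltW.
  exact: ler_wpM2l qP.
- by rewrite gt0_muley ?lte_fin // gt0_mulye ?lte_fin // leey.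
Qed.
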